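(* Let $G$ be a loopless graph (multigraph, parallel edges allowed) with maximum degree $\Delta$ and chromatic index $\chi'(G)\geq \Delta+2$. Let $\varphi$ be a partial $k$-edge-colouring of $G$ with $k\geq \Delta+1$ colours, and let $e_0$ be an edge left uncoloured by $\varphi$. Fix $T$ to be any maximal $\varphi$-Tashkinov tree starting at $e_0$ (so $V(T)=W^{\varphi}_{e_0}$). If none of the following statements is true: \begin{enumerate} \item[(1)] there is a sequence of Kempe changes transforming $\varphi$ into a partial $k$-edge-colouring $\varphi'$ in which the two ends of $e_0$ have a common missing colour; \item[(2)] there is a sequence of Kempe changes transforming $\varphi$ into a partial $k$-edge-colouring $\varphi'$ with $|W^{\varphi'}_{e_0}|>|W^{\varphi}_{e_0}|$; \item[(3)] $\chi'(G)\geq \lceil\rho(G[W^{\varphi}_{e_0}])\rceil > k$; \end{enumerate} then all of the following statements are true: \begin{enumerate} \item[(a)] $W^{\varphi}_{e_0}$ is $\varphi$-elementary and has at least one defective colour, and each defective colour appears on an odd number of edges between $W^{\varphi}_{e_0}$ and $V(G)\setminus W^{\varphi}_{e_0}$. \item[(b)] If $\beta\in \mathcal{M}^{\varphi}_{e_0}\setminus \mathcal{U}^{\varphi}_T$ and $\alpha\in\mathcal{D}^{\varphi}_{e_0}$, then the maximal $(\alpha,\beta)$-alternating path $P_{\alpha,\beta}$ that starts in $W^{\varphi}_{e_0}$ (at the vertex of $W^{\varphi}_{e_0}$ missing $\beta$) contains all edges coloured $\alpha$ having exactly one end in $W^{\varphi}_{e_0}$. Moreover, if $w_1,w_2$ are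 the first two vertices of $P_{\alpha,\beta}$ that are not in $W^{\varphi}_{e_0}$, then $W^{\varphi}_{e_0}\cup\{w_1,w_2\}$ is $\varphi$-elementary. \item[(c)] With $\alpha,\beta,P_{\alpha,\beta},w_1$ as in (b), let $Q_{\alpha,\beta}$ be the maximal-length segment of $P_{\alpha,\beta}$ which starts at $w_1$ and contains no vertices of $W^{\varphi}_{e_0}$. Then $W^{\varphi}_{e_0}\cup V(Q_{\alpha,\beta})$ is $\varphi$-elementary. \end{enumerate}
   Context: A partial $k$-edge-colouring of $G$ assigns to some edges colours from $\{1,\dots,k\}$ so that adjacent edges get different colours. A colour is missing at a vertex $v$ if no edge incident to $v$ has that colour. For two colours $a,b$, the edges coloured $a$ or $b$ induce a subgraph whose components are paths or even cycles; a Kempe change swaps $a$ and $b$ on one such component. An $(\alpha,\beta)$-alternating path is a path whose edges are alternately coloured $\alpha$ and $\beta$. The set $W^{\varphi}_{e_0}\subseteq V(G)$ is defined recursively: the two ends of $e_0$ are in it; a vertex $v$ is added if for some colour $\gamma$ there is an edge $e_v$ coloured $\gamma$ joining a vertex already in the set to $v$, and some vertex already in the set is missing $\gamma$. At any stage the current vertices together with $e_0$ and the edges $e_v$ used form a tree, called a $\varphi$-Tashkinov tree starting at $e_0$; a maximal such tree has vertex set exactly $W^{\varphi}_{e_0}$ (which is uniquely determined). A set $X\subseteq V(G)$ is $\varphi$-elementary if no two distinct vertices of $X$ have a common missing colour. A colour is defective for $W^{\varphi}_{e_0}$ if it occurs on more than one edge between $W^{\varphi}_{e_0}$ and $V(G)\setminus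 W^{\varphi}_{e_0}$. $\mathcal{M}^{\varphi}_{e_0}$ is the set of colours missing at at least one vertex of $W^{\varphi}_{e_0}$; $\mathcal{D}^{\varphi}_{e_0}$ is the set of defective colours for $W^{\varphi}_{e_0}$; $\mathcal{U}^{\varphi}_T$ is the set of colours appearing on the edges of $T$. For a graph $H$, $\rho(H)=\max\{\tfrac{2|E(H[S])|}{|S|-1}: S\subseteq V(H),\ |S|\text{ odd},\ |S|\ge 3\}$. *)

(* Defs.v *)
From mathcomp Require Import all_boot all_order all_algebra.
Set Implicit Arguments. Unset Strict Implicit. Unset Printing Implicit Defensive.
Import Order.TTheory GRing.Theory Num.Theory.

Record graph (V E : finType) := Graph { src : E -> V; dst : E -> V }.

Section Defs.
Variables (V E : finType) (G : graph V E).

Definition loopless := forall e : E, src G e != dst G e.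

Definition incident (v : V) (e : E) : bool := (src G e == v) || (dst G e == v).

Definition joins (e : E) (u v : V) : bool :=
  ((src G e == u) && (dst G e == v)) || ((src G e == v) && (dst G e == u)).

Definition adjacent (e f : E) : bool :=
  [exists v, incident v e && incident v f].

Definition degree (v : V) : nat := #|[set e | incident v e]|.

Definition max_degree : nat := \max_(v : V) degree v.

Definition proper_total (n : nat) (c : {ffun E -> 'I_n}) : bool :=
  [forall e, forall f, ((e != f) && adjacent e f) ==> (c e != c f)].

Definition colourable (n : nat) : bool :=
  [exists c : {ffun E -> 'I_n}, proper_total c].

Lemma colourable_ex : exists n, colourable n.
Proof.
exists #|E|; apply/existsP; exists [ffun e => enum_rank e].
apply/forallP => e; apply/forallP => f; apply/implyP => /andP [nef _].
by rewrite !ffunE; apply: contra nef => /eqP /enum_rank_inj ->.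
Qed.

Definition chromatic_index : nat := ex_minn colourable_ex.

Section Colouring.
Variable k : nat.
(* colours are 'I_k (i.e. {0,...,k-1}); None = uncoloured *)
Definition partial_colouring (phi : E -> option 'I_k) : Prop :=
  forall e f, e != f -> adjacent e f -> phi e != None -> phi e != phi f.

Definition missing (phi : E -> option 'I_k) (v : V) (c : 'I_k) : bool :=
  ~~ [exists e, incident v e && (phi e == Some c)].

Definition kempe_step (phi phi' : E -> option 'I_k) : Prop :=
  exists (a b : 'I_k) (e : E),
    let ab := fun f => (phi f == Some a) || (phi f == Some b) in
    let r : rel E := fun f g => [&& ab f, ab g & adjacent f g] in
    ab e /\
    forall f, phi' f =
      if ab f && connect r e f then
        (if phi f == Some a then Some b else Some a)
      else phi f.

Inductive kempe_reach (phi : E -> option 'I_k) : (E -> option 'I_k) -> Prop :=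
  | kempe_refl : kempe_reach phi phi
  | kempe_trans phi1 phi2 : kempe_reach phi phi1 -> kempe_step phi1 phi2 ->
      kempe_reach phi phi2.

Section Tashkinov.
Variables (phi : E -> option 'I_k) (e0 : E).

Definition W_step (X : {set V}) : {set V} :=
  [set src G e0; dst G e0] :|:
  [set v | [exists f, [exists c,
     [&& phi f == Some c, [exists u in X, joins f u v]
       & [exists x in X, missing phi x c]]]]].

Definition W : {set V} := fixset W_step.

(* Tashkinov tree: a sequence of (new vertex v, edge e_v) pairs *)
Definition tstep (pre : seq V) (v : V) (f : E) : bool :=
  [&& v \notin pre, has (fun u => joins f u v) pre &
      [exists c, (phi f == Some c) && has (fun x => missing phi x c) pre]].

Fixpoint tt_ok (pre : seq V) (T : seq (V * E)) : bool :=
  if T is (v, f) :: T' then tstep pre v f && tt_ok (rcons pre v) T' else true.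

Definition tverts (T : seq (V * E)) : seq V :=
  [:: src G e0; dst G e0] ++ map fst T.

Definition tedges (T : seq (V * E)) : seq E := e0 :: map snd T.

Definition tashkinov_tree (T : seq (V * E)) : bool :=
  tt_ok [:: src G e0; dst G e0] T.

Definition max_tashkinov_tree (T : seq (V * E)) : bool :=
  tashkinov_tree T && [forall v, forall f, ~~ tstep (tverts T) v f].

Definition U_T (T : seq (V * E)) : {set 'I_k} :=
  [set c | [exists f, (f \in tedges T) && (phi f == Some c)]].

End Tashkinov.

Definition elementary (phi : E -> option 'I_k) (X : {set V}) : Prop :=
  forall x y, x \in X -> y \in X -> x != y ->
    forall c, ~~ (missing phi x c && missing phi y c).

Definition crossing (X : {set V}) (f : E) : bool :=
  (src G f \in X) != (dst G f \in X).

Definition crossing_col (phi : E -> option 'I_k) (X : {set V}) (c : 'I_k) :=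
  [set f | (phi f == Some c) && crossing X f].

Definition Mset (phi : E -> option 'I_k) (X : {set V}) : {set 'I_k} :=
  [set c | [exists x in X, missing phi x c]].

Definition Dset (phi : E -> option 'I_k) (X : {set V}) : {set 'I_k} :=
  [set c | 1 < #|crossing_col phi X c|].

(* (a,b)-alternating walk from u: edges coloured a, b, a, b, ...;
   the list records (edge, vertex reached). *)
Fixpoint alt_walk (phi : E -> option 'I_k) (a b : 'I_k) (u : V)
    (p : seq (E * V)) : bool :=
  if p is (e, v) :: p' then
    [&& joins e u v, phi e == Some a & alt_walk phi b a v p']
  else true.

Definition alt_path phi a b (x : V) (p : seq (E * V)) : bool :=
  alt_walk phi a b x p && uniq (x :: map snd p).

Definition max_alt_path phi a b x p : bool :=
  alt_path phi a b x p && [forall e, forall v, ~~ alt_path phi a b x (rcons p (e, v))].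

Definition pverts (x : V) (p : seq (E * V)) : seq V := x :: map snd p.

End Colouring.

Definition inner_edges (S : {set V}) : nat :=
  #|[set e | (src G e \in S) && (dst G e \in S)]|.

(* rho(G[X]) (taken to be 0 when X has no odd subset of size >= 3) *)
Definition rho (X : {set V}) : rat :=
  \big[Num.max/0%R]_(S : {set V} | [&& S \subset X, odd #|S| & 2 < #|S|])
     (((2 * inner_edges S)%:R / (#|S|.-1)%:R)%R : rat).

End Defs.

(* Main.v *)
Require Import Defs.
From Stdlib Require Import FunctionalExtensionality.
From mathcomp Require Import all_boot all_order all_algebra perm zify.
Import Order.TTheory GRing.Theory Num.Theory.
Set Implicit Arguments.
Unset Strict Implicit.
Unset Printing Implicit Defensive.

(** All recolourings are swaps of two colours [a], [b] on a vertex set [Z] that no edge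
coloured [a] or [b] leaves; such a swap is a sequence of Kempe changes.

Tashkinov's theorem.  Write a Tashkinov tree as a head followed by a tail that is a path,
and argue by induction on the size of the head, then on the length of the tail.  Suppose
the last vertex [y] shares a missing colour with the rest of the tree.  An elementary tree
on [m] vertices misses at least [m + 2] colours and uses at most [m - 2], so unused missing
colours are always available, and swapping on the chain of [y] trades the shared colour
for another one that is unused so far.  Repeating this along the tree makes the shared
colour unused in the whole tree before [y]: an obstruction would be a two-coloured chain
from [y] back to an initial part of the head, hence a tree with a smaller head and a path
tail ending in [y].  With such a colour one recolours the last edge, or drops the last
vertex of the head, and contradicts the induction hypothesis.

The theorem.  Counting the edges of each colour inside [W] gives (a).  If a colour [b] is
missing at [x] in [W] and unused in the tree, swapping the [(a, b)]-chain of [x] keeps the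
tree, so by maximality of [W] that chain contains all crossing edges of a defective colour
[a].  Consequently, under every admissible recolouring, the chain cannot stop during its
first excursion out of [W]; a colour missing twice on [W] and the excursion can be moved
by Kempe changes, as for Kierstead paths, until it makes the chain stop there. *)

(** * Kempe swaps *)

Section Kempe.
Variables (V E : finType) (G : graph V E) (k : nat).
Implicit Types (phi psi : E -> option 'I_k) (a b c d : 'I_k) (Z : {set V}).

Definition bicol phi a b f := (phi f == Some a) || (phi f == Some b).

(** Such a [Z] splits no component of the two-coloured subgraph. With vertex sets instead of edge
    components, missing colours after a swap obey a simple formula and several components can be
    swapped at once. *)
Definition kempe_closed phi a b Z :=
  forall f, bicol phi a b f -> (src G f \in Z) = (dst G f \in Z).

(** Testing the source alone suffices on a closed [Z]: the ends of an edge coloured [a] or [b] lie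
    on the same side, and the transposition fixes all other colours. *)
Definition swap phi a b Z : E -> option 'I_k :=
  fun f => if src G f \in Z then omap (tperm a b) (phi f) else phi f.

Lemma joinsC f u v : joins G f u v = joins G f v u.
Proof. by rewrite /joins orbC. Qed.

Lemma joins_incidentl f u v : joins G f u v -> incident G u f.
Proof. by rewrite /joins /incident => /orP[] /andP[h1 h2]; rewrite ?h1 ?h2 ?orbT. Qed.

Lemma joins_incidentr f u v : joins G f u v -> incident G v f.
Proof. by rewrite joinsC; apply: joins_incidentl. Qed.

Lemma joins_srcdst f : joins G f (src G f) (dst G f).
Proof. by rewrite /joins !eqxx. Qed.

Lemma incident_src f : incident G (src G f) f.
Proof. by rewrite /incident eqxx. Qed.

Lemma incident_dst f : incident G (dst G f) f.
Proof. by rewrite /incident eqxx orbT. Qed.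

Lemma incident_joins f u : incident G u f -> exists v, joins G f u v.
Proof.
by case/orP=> /eqP <-; [exists (dst G f) | exists (src G f); rewrite joinsC];
  apply: joins_srcdst.
Qed.

Lemma joins_incident f u v w :
  joins G f u v -> incident G w f -> (w == u) || (w == v).
Proof.
rewrite /joins /incident.
by case/orP=> /andP[/eqP-> /eqP->] /orP[]/eqP->; rewrite eqxx ?orbT.
Qed.

Lemma bicolC phi a b f : bicol phi a b f = bicol phi b a f.
Proof. by rewrite /bicol orbC. Qed.

Lemma bicol_l phi a b f : phi f = Some a -> bicol phi a b f.
Proof. by rewrite /bicol => ->; rewrite eqxx. Qed.

Lemma bicol_r phi a b f : phi f = Some b -> bicol phi a b f.
Proof. by rewrite /bicol => ->; rewrite eqxx orbT. Qed.

Lemma proper_inj phi v f g c : partial_colouring G phi ->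
  incident G v f -> incident G v g -> phi f = Some c -> phi g = Some c -> f = g.
Proof.
move=> pc vf vg fc gc; apply/eqP/negPn/negP => nfg.
have adj : adjacent G f g by apply/existsP; exists v; rewrite vf.
by have := pc f g nfg adj; rewrite fc gc eqxx => /(_ isT).
Qed.

Lemma missingP phi v c f : missing G phi v c -> incident G v f -> phi f <> Some c.
Proof.
by move=> /existsPn /(_ f); rewrite negb_and => /orP[/negP|/eqP].
Qed.

Lemma missingPn phi v c : ~~ missing G phi v c ->
  exists2 f, incident G v f & phi f = Some c.
Proof. by move/negPn/existsP=> [f /andP[vf /eqP fc]]; exists f. Qed.

Lemma has_col_not_missing phi v c f :
  incident G v f -> phi f = Some c -> missing G phi v c = false.
Proof. by move=> vf fc; case m: (missing _ _ _ _) => //; case: (missingP m vf fc). Qed.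

Lemma omap_tperm_id a b (o : option 'I_k) :
  ~~ ((o == Some a) || (o == Some b)) -> omap (tperm a b) o = o.
Proof.
case: o => [c|] //= /norP[ha hb]; congr Some.
by rewrite tpermD //; [move: ha|move: hb]; apply: contra => /eqP->.
Qed.

Lemma closed_joins phi a b Z f u v : kempe_closed phi a b Z ->
  bicol phi a b f -> joins G f u v -> (u \in Z) = (v \in Z).
Proof.
by move=> cl /cl e /orP[]/andP[/eqP<- /eqP<-].
Qed.

Lemma closed_incident phi a b Z f u v : kempe_closed phi a b Z ->
  bicol phi a b f -> incident G u f -> incident G v f -> (u \in Z) = (v \in Z).
Proof. by move=> cl /cl e /orP[]/eqP<- /orP[]/eqP<-. Qed.

Lemma swapE phi a b Z v f : kempe_closed phi a b Z -> incident G v f ->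
  swap phi a b Z f = if v \in Z then omap (tperm a b) (phi f) else phi f.
Proof.
move=> cl vf; rewrite /swap.
case abf: (bicol phi a b f); last
  by rewrite omap_tperm_id ?if_same // -[_ || _]/(bicol phi a b f) abf.
by case/orP: vf => /eqP <-; rewrite ?(cl _ abf).
Qed.

Lemma swap_bicol phi a b Z f : bicol (swap phi a b Z) a b f = bicol phi a b f.
Proof.
rewrite /bicol /swap; case: ifP => // _; case: (phi f) => [c|] //=.
have E1 x y : (Some x == Some y :> option 'I_k) = (x == y) by [].
rewrite !E1; case: tpermP => [->|->|/eqP/negPf na /eqP/negPf nb] //.
- by rewrite eqxx orbT eqxx.
- by rewrite eqxx eqxx orbT.
Qed.

Lemma swap_other phi a b Z f : ~~ bicol phi a b f -> swap phi a b Z f = phi f.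
Proof. by move=> h; rewrite /swap omap_tperm_id ?if_same. Qed.

Lemma swap_colD phi a b Z f c : c != a -> c != b ->
  (swap phi a b Z f == Some c) = (phi f == Some c).
Proof.
move=> ca cb; case h: (bicol phi a b f); last by rewrite swap_other ?h.
have h2 := h; rewrite -(swap_bicol phi a b Z) in h2.
by case/orP: h2 => /eqP->; case/orP: h => /eqP->; apply/eqP/eqP => -[] e;
   move: ca cb; rewrite e eqxx.
Qed.

Lemma swap_notin phi a b Z v f : kempe_closed phi a b Z -> incident G v f ->
  v \notin Z -> swap phi a b Z f = phi f.
Proof. by move=> cl vf nv; rewrite (swapE cl vf) (negPf nv). Qed.

Lemma omap_tperm_eq a b (o : option 'I_k) c :
  (omap (tperm a b) o == Some c) = (o == Some (tperm a b c)).
Proof.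
case: o => [x|] //=.
have E1 y z : (Some y == Some z :> option 'I_k) = (y == z) by [].
by rewrite !E1 (canF_eq (tpermK a b)).
Qed.

Lemma missing_swap phi a b Z v c : kempe_closed phi a b Z ->
  missing G (swap phi a b Z) v c =
  missing G phi v (if v \in Z then tperm a b c else c).
Proof.
move=> cl; congr negb; apply: eq_existsb => f.
case vf: (incident G v f) => //=; rewrite (swapE cl vf).
by case: ifP; rewrite ?omap_tperm_eq.
Qed.

Lemma missing_swapD phi a b Z v c : kempe_closed phi a b Z ->
  c != a -> c != b -> missing G (swap phi a b Z) v c = missing G phi v c.
Proof.
by move=> cl ca cb; rewrite missing_swap // tpermD 1?eq_sym ?if_same // eq_sym.
Qed.

Lemma missing_swap_notin phi a b Z v c : kempe_closed phi a b Z ->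
  v \notin Z -> missing G (swap phi a b Z) v c = missing G phi v c.
Proof. by move=> cl /negPf vZ; rewrite missing_swap // vZ. Qed.

Lemma swap_proper phi a b Z : kempe_closed phi a b Z ->
  partial_colouring G phi -> partial_colouring G (swap phi a b Z).
Proof.
move=> cl pc e f nef adj; have := pc e f nef adj.
case/existsP: adj => v /andP[ve vf]; rewrite (swapE cl ve) (swapE cl vf).
case: ifP => // _; case: (phi e) => [x|] //=; case: (phi f) => [y|] //= h _.
have := h isT; apply: contra => /eqP [] /perm_inj -> //.
Qed.

(** * Edge components and their vertex sets *)

Section Component.
Variables (phi : E -> option 'I_k) (a b : 'I_k).

Definition edge_adj : rel E :=
  fun f g => [&& bicol phi a b f, bicol phi a b g & adjacent G f g].

Definition edge_comp (e : E) : {set V} :=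
  [set v | [exists f, [&& bicol phi a b f, connect edge_adj e f & incident G v f]]].

Lemma edge_comp_mem e f v : bicol phi a b f -> incident G v f ->
  (v \in edge_comp e) = connect edge_adj e f.
Proof.
move=> abf vf; rewrite inE; apply/existsP/idP => [[g /and3P[abg eg vg]]|ef]; last first.
  by exists f; rewrite abf ef.
apply: connect_trans eg (connect1 _); rewrite /edge_adj abg abf /=.
by apply/existsP; exists v; rewrite vg.
Qed.

Lemma edge_comp_closed e : kempe_closed phi a b (edge_comp e).
Proof.
move=> f abf.
by rewrite (edge_comp_mem _ abf (incident_src f)) (edge_comp_mem _ abf (incident_dst
  f)).
Qed.

Lemma kempe_step_swap_comp e : bicol phi a b e ->
  kempe_step G phi (swap phi a b (edge_comp e)).
Proof.
move=> abe; exists a, b, e; split => // f.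
rewrite /swap -/(bicol phi a b f); case abf: (bicol phi a b f); last first.
  by rewrite omap_tperm_id ?if_same // -[_ || _]/(bicol phi a b f) abf.
rewrite (edge_comp_mem _ abf (incident_src f)) /=; case: ifP => // _.
case/orP: abf => /eqP->; rewrite /= ?tpermL ?tpermR ?eqxx //.
by case: eqP => // -[->].
Qed.

End Component.

Lemma kempe_step_is_swap phi psi : kempe_step G phi psi ->
  exists a b Z, kempe_closed phi a b Z /\ psi = swap phi a b Z.
Proof.
case=> a [b [e [abe h]]]; exists a, b, (edge_comp phi a b e).
split; first exact: edge_comp_closed.
apply: functional_extensionality => f; rewrite h -/(bicol phi a b f) /swap.
case abf: (bicol phi a b f); last first.
  by rewrite omap_tperm_id ?if_same // -[_ || _]/(bicol phi a b f) abf.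
rewrite (edge_comp_mem _ abf (incident_src f)) /=; case: ifP => // _.
case/orP: abf => /eqP->; rewrite /= ?tpermL ?tpermR ?eqxx //.
by case: eqP => // -[->].
Qed.

Lemma kempe_reach_trans phi psi chi : kempe_reach G phi psi ->
  kempe_reach G psi chi -> kempe_reach G phi chi.
Proof. by move=> r1; elim=> // p1 p2 _ r2; apply: kempe_trans. Qed.

(** Induction on the number of two-coloured edges inside [Z]: swap the component [C] of one of them,
    then [Z :\: C], which is still closed. *)
Lemma kempe_reach_swap phi a b Z : kempe_closed phi a b Z ->
  kempe_reach G phi (swap phi a b Z).
Proof.
have [n] := ubnP #|[set f | bicol phi a b f & src G f \in Z]|.
elim: n phi Z => // n IH phi Z; rewrite ltnS => le cl.
case: (pickP [pred f | bicol phi a b f & src G f \in Z]) => [e /= /andP[abe eZ]|none];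
  last first.
  suff -> : swap phi a b Z = phi by apply: kempe_refl.
  apply: functional_extensionality => f; rewrite /swap; case: ifP => // fZ.
  have := none f; rewrite /= fZ andbT => abf.
  by rewrite omap_tperm_id // -[_ || _]/(bicol phi a b f) abf.
set C := edge_comp phi a b e.
have clC : kempe_closed phi a b C by apply: edge_comp_closed.
have CZ f : bicol phi a b f -> src G f \in C -> src G f \in Z.
  move=> abf; rewrite (edge_comp_mem _ abf (incident_src f)).
  case/connectP => p; elim: p e eZ abe {le C clC} => [|g p IHp] e eZ abe /=.
    by move=> _ ->.
  case/andP=> /and3P[_ abg /existsP[v /andP[ve vg]]] pp lst.
  apply: IHp pp lst => //.
  have sv h : bicol phi a b h -> incident G v h -> (src G h \in Z) = (v \in Z).
    by move=> /cl abh /orP[]/eqP<-.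
  by rewrite (sv g) // -(sv e).
have step := kempe_step_swap_comp abe; rewrite -/C in step.
have clD : kempe_closed (swap phi a b C) a b (Z :\: C).
  by move=> f; rewrite swap_bicol !in_setD => abf; rewrite (cl f) // (clC f).
have -> : swap phi a b Z = swap (swap phi a b C) a b (Z :\: C).
  apply: functional_extensionality => f.
  case abf: (bicol phi a b f); last by rewrite !swap_other ?swap_bicol ?abf.
  rewrite /swap in_setD; have := CZ f abf.
  by case: (src G f \in C) => //= ->.
apply: kempe_reach_trans (kempe_trans (kempe_refl _ _) step) _.
apply: IH clD; apply: leq_trans le; apply: proper_card; apply/properP; split.
  by apply/subsetP => f; rewrite in_set swap_bicol in_setD => /and3P[h1 _ h2];
    rewrite in_set h1 h2.
exists e; rewrite in_set ?abe ?eZ // swap_bicol abe /= in_setD negb_and negbK.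
have -> // : src G e \in C.
by rewrite (edge_comp_mem _ abe (incident_src e)) connect0.
Qed.

Lemma kempe_reach_proper phi psi : partial_colouring G phi ->
  kempe_reach G phi psi -> partial_colouring G psi.
Proof.
move=> pc; elim=> // p1 p2 _ pc1 /kempe_step_is_swap [a [b [Z [cl ->]]]].
exact: swap_proper.
Qed.

Lemma kempe_reach_uncoloured phi psi e : phi e = None ->
  kempe_reach G phi psi -> psi e = None.
Proof.
move=> pe; elim=> // p1 p2 _ h /kempe_step_is_swap [a [b [Z [cl ->]]]].
by rewrite /swap h /= if_same.
Qed.

(** * Components indexed by a vertex *)

Definition vadj phi a b : rel V :=
  fun u v => [exists f, bicol phi a b f && joins G f u v].

Definition kcomp phi a b u : {set V} := [set v | connect (vadj phi a b) u v].

Lemma vadj_sym phi a b : symmetric (vadj phi a b).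
Proof. by move=> u v; apply: eq_existsb => f; rewrite joinsC. Qed.

Lemma kcomp_refl phi a b u : u \in kcomp phi a b u.
Proof. by rewrite inE connect0. Qed.

Lemma kcomp_sym phi a b u v : (v \in kcomp phi a b u) = (u \in kcomp phi a b v).
Proof. rewrite !inE; apply: sym_connect_sym; apply: vadj_sym. Qed.

Lemma kcomp_trans phi a b u v w : v \in kcomp phi a b u -> w \in kcomp phi a b v ->
  w \in kcomp phi a b u.
Proof. by rewrite !inE; apply: connect_trans. Qed.

Lemma kcomp_closed phi a b u : kempe_closed phi a b (kcomp phi a b u).
Proof.
move=> f abf; rewrite !inE; apply/idP/idP => h; apply: connect_trans h (connect1 _).
  by apply/existsP; exists f; rewrite abf joins_srcdst.
by apply/existsP; exists f; rewrite abf joinsC joins_srcdst.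
Qed.

Lemma kcomp_sub phi a b u Z : kempe_closed phi a b Z -> u \in Z ->
  {subset kcomp phi a b u <= Z}.
Proof.
move=> cl uZ v; rewrite inE => /connectP[p]; elim: p u uZ => [|w p IH] u uZ /=.
  by move=> _ ->.
by case/andP=> /existsP[f /andP[abf fuw]]; apply: IH;
  rewrite -(closed_joins cl abf fuw).
Qed.

End Kempe.

Arguments kcomp_closed {V E} G {k} phi a b u f _.

(** * Alternating walks *)

Section AltWalk.
Variables (V E : finType) (G : graph V E) (k : nat).
Variables (phi : E -> option 'I_k).
Hypothesis phi_proper : partial_colouring G phi.
Implicit Types (a b c d : 'I_k) (p q : seq (E * V)).

Lemma alt_walk_cat a b x p q : alt_walk G phi a b x (p ++ q) =
  alt_walk G phi a b x p &&
  alt_walk G phi (if odd (size p) then b else a) (if odd (size p) then a else b)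
    (last x (map snd p)) q.
Proof.
elim: p a b x => [|[e v] p IH] a b x //=.
by rewrite IH -!andbA; case: (odd (size p)).
Qed.

Lemma alt_walk_edges a b x p f v : alt_walk G phi a b x p ->
  f \in map fst p -> incident G v f -> v \in x :: map snd p.
Proof.
elim: p a b x => [|[e y] p IH] a b x //= /and3P[exy _ w].
rewrite inE => /orP[/eqP->|fp] vf.
  by rewrite !inE; case/orP: (joins_incident exy vf) => ->; rewrite ?orbT.
by rewrite inE (IH _ _ _ w fp vf) orbT.
Qed.

(* [F] collects the edges coloured [b] at the start of the walk, so that the
   statement survives dropping the first edge. *)
Lemma alt_walk_inner_gen a b x p (F : seq E) :
  (forall f, incident G x f -> phi f = Some b -> f \in F) ->
  alt_walk G phi a b x p ->
  (forall v f, v \in belast x (map snd p) -> bicol phi a b f ->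
     incident G v f -> f \in F ++ map fst p) /\
  (forall f, incident G (last x (map snd p)) f ->
     phi f = Some (if odd (size p) then a else b) -> f \in F ++ map fst p).
Proof.
elim: p a b x F => [|[e y] p IH] a b x F hF /=.
  by move=> _; split=> // f; rewrite cats0; apply: hF.
case/and3P=> exy /eqP ea w.
have [|IH1 IH2] := IH b a y (rcons F e) _ w.
  move=> f yf fa; rewrite mem_rcons inE.
  by rewrite (proper_inj phi_proper yf (joins_incidentr exy) fa ea) eqxx.
split=> [v f|f lf]; last first.
  by rewrite -cat_rcons => h; apply: IH2 => //; move: h; case: (odd (size p)).
rewrite inE => /orP[/eqP->|vp] abf vf; last first.
  by rewrite -cat_rcons (IH1 v) // bicolC.
case/orP: abf => /eqP fc; last by rewrite mem_cat hF.
rewrite mem_cat inE.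
by rewrite (proper_inj phi_proper vf (joins_incidentl exy) fc ea) eqxx orbT.
Qed.

Lemma alt_walk_inner a b x p v f : missing G phi x b -> alt_walk G phi a b x p ->
  v \in belast x (map snd p) -> bicol phi a b f -> incident G v f ->
  f \in map fst p.
Proof.
move=> mx w; have [|h _] := @alt_walk_inner_gen a b x p [::] _ w.
  by move=> g xg /(missingP mx xg).
exact: h.
Qed.

(** The parity test names the colour of the last edge of the walk; for an empty walk it names [b],
    which [x] misses. *)
Lemma alt_walk_last a b x p f : missing G phi x b -> alt_walk G phi a b x p ->
  incident G (last x (map snd p)) f ->
  phi f = Some (if odd (size p) then a else b) -> f \in map fst p.
Proof.
move=> mx w; have [|_ h] := @alt_walk_inner_gen a b x p [::] _ w.
  by move=> g xg /(missingP mx xg).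
exact: h.
Qed.

Lemma alt_walk_last_has a b x p : alt_walk G phi a b x p -> p != [::] ->
  ~~ missing G phi (last x (map snd p)) (if odd (size p) then a else b).
Proof.
case/lastP: p => // p [e y]; rewrite -cats1 alt_walk_cat => /andP[_] /=.
rewrite andbT => /andP[eu /eqP ec] _.
rewrite map_cat last_cat /= size_cat addn1 /=.
apply/negP => m; apply: (missingP m (joins_incidentr eu)).
by rewrite ec; case: (odd (size p)).
Qed.

Lemma alt_walk_interior a b x p v : alt_walk G phi a b x p ->
  v \in belast x (map snd p) -> v != x ->
  ~~ missing G phi v a && ~~ missing G phi v b.
Proof.
elim: p a b x => [|[e y] p IH] a b x //= /and3P[exy /eqP ea w].
rewrite inE => /orP[->//|vp] _; have [vy|nvy] := eqVneq v y; last first.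
  by rewrite andbC (IH b a y).
case: p w vp {IH} => [|[g z] p] //= /and3P[gyz /eqP gb _] _.
rewrite vy (has_col_not_missing (joins_incidentr exy) ea).
by rewrite (has_col_not_missing (joins_incidentl gyz) gb).
Qed.

Lemma bicol_if (s : bool) a b f : bicol phi a b f ->
  phi f = Some (if s then a else b) \/ phi f = Some (if s then b else a).
Proof. by case/orP=> /eqP->; case: s; [left|right|right|left]. Qed.

(** All vertices but the last have their edges coloured [a] or [b] on the walk, so only the
    continuing colour at the last vertex could lead out. The hypothesis covers both a last vertex
    missing that colour and a maximal path whose next edge returns to it. *)
Lemma alt_walk_closed a b x p : missing G phi x b -> alt_walk G phi a b x p ->
  (forall f v, joins G f (last x (map snd p)) v ->
     phi f = Some (if odd (size p) then b else a) -> v \in x :: map snd p) ->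
  kempe_closed G phi a b [set v in x :: map snd p].
Proof.
move=> mx w hl.
have half f u v : bicol phi a b f -> joins G f u v ->
    u \in x :: map snd p -> v \in x :: map snd p.
  move=> abf fuv up; have uf := joins_incidentl fuv; have vf := joins_incidentr fuv.
  suff [fp|//] : f \in map fst p \/ v \in x :: map snd p
    by apply: alt_walk_edges w fp vf.
  rewrite lastI mem_rcons inE in up; case/orP: up => [/eqP ul|ub]; last first.
    by left; apply: alt_walk_inner ub abf uf.
  rewrite ul in uf fuv.
  case: (bicol_if (odd (size p)) abf) => fc; first by left; apply: alt_walk_last uf fc.
  by right; apply: hl fuv fc.
move=> f abf; rewrite !in_set; apply/idP/idP; apply: (half f) => //.
  exact: joins_srcdst.
by rewrite joinsC joins_srcdst.
Qed.

Lemma max_alt_path_exists a b x : exists p, max_alt_path G phi a b x p.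
Proof.
(* [n] bounds the number of further extensions, since a path has at most [#|V|] vertices. *)
suff H n p : alt_path G phi a b x p -> #|V| <= size p + n ->
    exists q, max_alt_path G phi a b x q.
  by apply: (H #|V| [::]) => //=; rewrite /alt_path.
elim: n p => [|n IH] p ap le.
  have /andP[_ un] := ap; have := card_uniqP un; have := max_card [in x :: map snd p].
  by move=> /[swap] ->; rewrite /= size_map => /leq_trans/(_ le); rewrite addn0 ltnn.
case mx: (max_alt_path G phi a b x p); first by exists p.
move: mx; rewrite /max_alt_path ap /= => /negbT.
rewrite negb_forall => /existsP[e]; rewrite negb_forall => /existsP[v /negPn h].
by apply: IH h _; rewrite size_rcons addSnnS.
Qed.

Lemma max_alt_path_closed a b x p : missing G phi x b ->
  max_alt_path G phi a b x p -> kempe_closed G phi a b [set v in x :: map snd p].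
Proof.
move=> mx /andP[/andP[w un] /forallP mp]; apply: alt_walk_closed => // f v fv fc.
have /forallP/(_ v) := mp f.
rewrite /alt_path map_rcons -rcons_cons rcons_uniq un -cats1 alt_walk_cat w /=.
by rewrite fv fc eqxx !andbT => /negPn.
Qed.

Lemma kcomp_sub_path a b x p : missing G phi x b -> max_alt_path G phi a b x p ->
  {subset kcomp G phi a b x <= x :: map snd p}.
Proof.
move=> mx mp v /(kcomp_sub (max_alt_path_closed mx mp)); rewrite !in_set.
by apply; rewrite mem_head.
Qed.

(** A maximal path from [u] exhausts the component, and its interior vertices have both colours; so
    any other vertex missing one of them is the last vertex of the path. *)
Lemma kcomp_two_ends a b u v w :
  missing G phi u a || missing G phi u b ->
  missing G phi v a || missing G phi v b ->
  missing G phi w a || missing G phi w b ->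
  v \in kcomp G phi a b u -> w \in kcomp G phi a b u ->
  v != u -> w != u -> v = w.
Proof.
wlog mu : a b / missing G phi u b.
  move=> H /orP[] mu; last by apply: H; rewrite // mu orbT.
  have cC : kcomp G phi a b u = kcomp G phi b a u.
    apply/setP => z; rewrite !in_set; apply: eq_connect => s t.
    by apply: eq_existsb => f; rewrite bicolC.
  rewrite orbC (orbC (missing G phi w a)) cC.
  by apply: H; rewrite // mu orbT.
move=> _ mv mw vc wc vu wu; have [p mp] := max_alt_path_exists a b u.
have /andP[/andP[wk _] _] := mp.
suff L z : missing G phi z a || missing G phi z b -> z \in kcomp G phi a b u ->
    z != u -> z = last u (map snd p).
  by rewrite (L v mv vc vu) (L w mw wc wu).
move=> mz /(kcomp_sub_path mu mp); rewrite lastI mem_rcons inE => /orP[/eqP//|zb] zu.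
by have /andP[/negPf h1 /negPf h2] := alt_walk_interior wk zb zu; rewrite h1 h2 in mz.
Qed.

Lemma kcomp_isolated a b u : missing G phi u a -> missing G phi u b ->
  kcomp G phi a b u = [set u].
Proof.
move=> ma mb; apply/setP => v; rewrite inE; apply/idP/idP; last first.
  by move/eqP->; apply: kcomp_refl.
suff cl : kempe_closed G phi a b [set u].
  by move/(kcomp_sub cl); rewrite !inE; apply.
move=> f abf; rewrite !inE.
have n z : incident G z f -> (z == u) = false.
  move=> zf; apply/eqP => zu; rewrite zu in zf.
  by case/orP: abf => /eqP; [apply: missingP ma zf|apply: missingP mb zf].
by rewrite !n ?incident_src ?incident_dst.
Qed.

End AltWalk.

Lemma alt_walk_recolour (V E : finType) (G : graph V E) (k : nat)
    (phi psi : E -> option 'I_k) (a b a' b' : 'I_k) x p :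
  (forall f, f \in map fst p -> phi f = Some a -> psi f = Some a') ->
  (forall f, f \in map fst p -> phi f = Some b -> psi f = Some b') ->
  alt_walk G phi a b x p -> alt_walk G psi a' b' x p.
Proof.
elim: p a b a' b' x => [|[e y] p IH] a b a' b' x //= ha hb /and3P[-> /eqP ea w].
rewrite (ha e) ?mem_head // eqxx /=; apply: IH w => f fp.
  by apply: hb; rewrite inE fp orbT.
by apply: ha; rewrite inE fp orbT.
Qed.

(** * Tashkinov trees *)

Section Trees.
Variables (V E : finType) (G : graph V E) (k : nat) (e0 : E).
Hypothesis G_loopless : loopless G.
Hypothesis k_large : max_degree G < k.
Implicit Types (phi psi : E -> option 'I_k) (T P : seq (V * E)) (s pre : seq V).

Definition elem_seq psi s := forall x y c, x \in s -> y \in s ->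
  missing G psi x c -> missing G psi y c -> x = y.

Definition tcols psi T : seq (option 'I_k) := [seq psi f | f <- map snd T].

Lemma tstepP psi pre v f : reflect
  [/\ v \notin pre, exists2 r, r \in pre & joins G f r v
    & exists c x, [/\ psi f = Some c, x \in pre & missing G psi x c]]
  (tstep G psi pre v f).
Proof.
apply: (iffP and3P) => -[h1 h2 h3]; split => //.
- by case/hasP: h2 => r; exists r.
- by case/existsP: h3 => c /andP[/eqP fc /hasP[x xp mx]]; exists c, x.
- by case: h2 => r rp rv; apply/hasP; exists r.
- case: h3 => c [x [fc xp mx]]; apply/existsP; exists c.
  by rewrite fc eqxx; apply/hasP; exists x.
Qed.

Lemma tt_ok_cat psi pre T1 T2 : tt_ok G psi pre (T1 ++ T2) =
  tt_ok G psi pre T1 && tt_ok G psi (pre ++ map fst T1) T2.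
Proof.
elim: T1 pre => [|[v f] T1 IH] pre /=; first by rewrite cats0.
by rewrite IH cat_rcons andbA.
Qed.

Lemma tverts_cat T1 T2 : tverts G e0 (T1 ++ T2) = tverts G e0 T1 ++ map fst T2.
Proof. by rewrite /tverts map_cat catA. Qed.

Lemma tverts_rcons T v f : tverts G e0 (rcons T (v, f)) = rcons (tverts G e0 T) v.
Proof. by rewrite -cats1 tverts_cat cats1. Qed.

Lemma mem_tverts_rcons T v f x :
  (x \in tverts G e0 (rcons T (v, f))) = (x == v) || (x \in tverts G e0 T).
Proof. by rewrite tverts_rcons mem_rcons. Qed.

Lemma mem_tverts_cat T1 T2 x :
  (x \in tverts G e0 (T1 ++ T2)) = (x \in tverts G e0 T1) || (x \in map fst T2).
Proof. by rewrite tverts_cat mem_cat. Qed.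

Lemma tree_cat psi T1 T2 : tashkinov_tree G psi e0 (T1 ++ T2) =
  tashkinov_tree G psi e0 T1 && tt_ok G psi (tverts G e0 T1) T2.
Proof. exact: tt_ok_cat. Qed.

Lemma tree_rcons psi T v f : tashkinov_tree G psi e0 (rcons T (v, f)) =
  tashkinov_tree G psi e0 T && tstep G psi (tverts G e0 T) v f.
Proof. by rewrite -cats1 tree_cat /= andbT. Qed.

Lemma tcols_rcons psi T v f : tcols psi (rcons T (v, f)) = rcons (tcols psi T) (psi f).
Proof. by rewrite /tcols !map_rcons. Qed.

Lemma tcolsP psi T c :
  reflect (exists2 f, f \in map snd T & psi f = Some c) (Some c \in tcols psi T).
Proof. by apply: (iffP mapP) => -[f ft fc]; exists f. Qed.

Lemma tree_uniq psi T : tashkinov_tree G psi e0 T -> uniq (tverts G e0 T).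
Proof.
elim/last_ind: T => [|T [v f] IH]; first by rewrite /= inE andbT (G_loopless e0).
by rewrite tree_rcons tverts_rcons rcons_uniq => /andP[/IH-> /tstepP[->]].
Qed.

Lemma tree_edges psi T f v : tashkinov_tree G psi e0 T -> f \in map snd T ->
  incident G v f -> v \in tverts G e0 T.
Proof.
elim/last_ind: T => [|T [w g] IH] //.
rewrite tree_rcons map_rcons mem_tverts_rcons mem_rcons in_cons.
case/andP=> tT /tstepP[_ [r rp gr] _] /orP[/eqP-> vf|fT vf]; last by rewrite IH ?orbT.
by case/orP: (joins_incident gr vf) => /eqP->; rewrite ?eqxx // rp orbT.
Qed.

Lemma tree_cols psi T f : tashkinov_tree G psi e0 T -> f \in map snd T ->
  exists c x, [/\ psi f = Some c, x \in tverts G e0 T & missing G psi x c].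
Proof.
elim/last_ind: T => [|T [w g] IH] //.
rewrite tree_rcons map_rcons mem_rcons in_cons.
case/andP=> tT /tstepP[_ _ [c [x [gc xT mx]]]] /orP[/eqP->|fT].
  by exists c, x; split => //; rewrite mem_tverts_rcons xT orbT.
have [d [y [fd yT my]]] := IH tT fT.
by exists d, y; split => //; rewrite mem_tverts_rcons yT orbT.
Qed.

Lemma tree_cols_rcons psi T z g f : tashkinov_tree G psi e0 (rcons T (z, g)) ->
  f \in map snd (rcons T (z, g)) ->
  exists c x, [/\ psi f = Some c, x \in tverts G e0 T & missing G psi x c].
Proof.
rewrite tree_rcons map_rcons mem_rcons inE.
case/andP=> tT /tstepP[_ _ h] /orP[/eqP->|fT] //.
exact: tree_cols.
Qed.

(** Each tree edge has a colour missing at a vertex before [z], and by elementarity [z] misses none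
    of these colours. *)
Lemma last_unused psi T z g c : tashkinov_tree G psi e0 (rcons T (z, g)) ->
  elem_seq psi (tverts G e0 (rcons T (z, g))) -> missing G psi z c ->
  Some c \notin tcols psi (rcons T (z, g)).
Proof.
move=> tT el mz; apply/negP => /tcolsP[f fT fc].
have [d [x [fd xT mx]]] := tree_cols_rcons tT fT.
have dc : d = c by move: fc; rewrite fd => -[].
rewrite dc in mx; have xz : x = z.
  by apply: el mx mz; rewrite mem_tverts_rcons ?eqxx // xT orbT.
by move: tT; rewrite tree_rcons => /andP[_ /tstepP[]]; rewrite -xz xT.
Qed.

Lemma tt_ok_impl psi psi' pre T :
  (forall f c, f \in map snd T -> psi f = Some c ->
     exists2 c', psi' f = Some c' & forall s, {subset pre <= s} ->
       {subset s <= pre ++ map fst T} ->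
       has (fun x => missing G psi x c) s -> has (fun x => missing G psi' x c') s) ->
  tt_ok G psi pre T -> tt_ok G psi' pre T.
Proof.
elim: T pre => [|[v f] T IH] pre //= h /andP[/and3P[h1 h2 /existsP[c /andP[/eqP fc
  hc]]] ok].
have [|c' fc' hc'] := h f c _ fc; first by rewrite mem_head.
rewrite {1}/tstep h1 h2 /=; apply/andP; split.
  apply/existsP; exists c'; rewrite fc' eqxx /=; apply: hc' => // x xp.
  by rewrite mem_cat xp.
apply: IH ok => g d gT gd; have [|d' gd' hd'] := h g d _ gd;
  first by rewrite inE gT orbT.
exists d' => // s s1 s2; apply: hd' => x xs.
  by apply: s1; rewrite mem_rcons inE xs orbT.
by have := s2 x xs; rewrite cat_rcons.
Qed.

Lemma tt_ok_agree psi psi' pre T :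
  (forall f, f \in map snd T -> psi' f = psi f) ->
  (forall x c, x \in pre ++ map fst T -> Some c \in tcols psi T ->
     missing G psi x c -> missing G psi' x c) ->
  tt_ok G psi pre T -> tt_ok G psi' pre T.
Proof.
move=> hf hm; apply: tt_ok_impl => f c fT fc; exists c; first by rewrite hf.
move=> s _ s2 /hasP[x xs mx]; apply/hasP; exists x => //.
by apply: hm => //; [apply: s2 | apply/tcolsP; exists f].
Qed.

Lemma tt_ok_swap_unused psi a b Z pre T : kempe_closed G psi a b Z ->
  Some a \notin tcols psi T -> Some b \notin tcols psi T ->
  tt_ok G psi pre T -> tt_ok G (swap G psi a b Z) pre T.
Proof.
move=> cl ua ub; apply: tt_ok_agree => [f fT|x c _ ct].
  by apply: swap_other; apply/norP; split; [move: ua|move: ub]; apply: contra => /eqP h;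
     apply/tcolsP; exists f.
by rewrite missing_swapD //; [move: ua|move: ub]; apply: contraNneq => <-.
Qed.

Lemma tree_swap_unused psi a b Z T : kempe_closed G psi a b Z ->
  Some a \notin tcols psi T -> Some b \notin tcols psi T ->
  tashkinov_tree G psi e0 T -> tashkinov_tree G (swap G psi a b Z) e0 T.
Proof. exact: tt_ok_swap_unused. Qed.

(** Edges of [T] may be coloured [a] or [b]. After the swap they still have one of these colours,
    and both remain missing in [pre], at [u] and [v]. *)
Lemma tt_ok_swap_missing psi a b Z pre T u v : kempe_closed G psi a b Z ->
  u \in pre -> v \in pre -> u \notin Z -> v \notin Z ->
  missing G psi u a -> missing G psi v b ->
  tt_ok G psi pre T -> tt_ok G (swap G psi a b Z) pre T.
Proof.
move=> cl up vp uZ vZ mu mv; apply: tt_ok_impl => f c fT fc.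
case abf: (bicol psi a b f); last first.
  rewrite swap_other ?abf //; exists c => // s _ _ /hasP[x xs mx]; apply/hasP.
  exists x => //; move: abf; rewrite /bicol fc => /norP[ca cb].
  by rewrite missing_swapD.
have := abf; rewrite -(swap_bicol G psi a b Z) => /orP[]/eqP h.
  exists a => // s s1 _ _; apply/hasP; exists u; first exact: s1.
  by rewrite missing_swap_notin.
exists b => // s s1 _ _; apply/hasP; exists v; first exact: s1.
by rewrite missing_swap_notin.
Qed.

Lemma swap_tcols_unused psi a b Z T :
  Some a \notin tcols psi T -> Some b \notin tcols psi T ->
  tcols (swap G psi a b Z) T = tcols psi T.
Proof.
move=> ua ub; apply/eq_in_map => f fT; apply: swap_other.
by apply/norP; split; [move: ua|move: ub]; apply: contra => /eqP h;
     apply/tcolsP; exists f.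
Qed.

(** Some colour is missing everywhere because [k] exceeds the maximum degree; an end of [e0] misses
    one more, since [e0] counts in its degree but carries no colour. *)
Lemma card_missing psi v (m : nat) : psi e0 = None ->
  (if incident G v e0 then 1 else 0) = m ->
  m < #|[set c | missing G psi v c]|.
Proof.
move=> p0 mE.
pose A := [set f | incident G v f & psi f != None].
have le1 : #|[set c | ~~ missing G psi v c]| <= #|A|.
  have -> : #|[set c | ~~ missing G psi v c]| = #|[set Some c | c in [set c |
    ~~ missing G psi v c]]|.
    by rewrite card_imset //; move=> x y [].
  apply: leq_trans (leq_imset_card psi A); apply: subset_leq_card; apply/subsetP => o.
  case/imsetP=> c; rewrite inE => /missingPn[f vf fc] ->; apply/imsetP; exists f => //.
  by rewrite inE vf fc.
have le2 : #|A| + m <= degree G v.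
  rewrite -mE /degree; case: ifP => v0; last first.
    by rewrite addn0; apply: subset_leq_card; apply/subsetP => f;
      rewrite !inE => /andP[].
  rewrite addnC [X in _ <= X](cardsD1 e0) in_set v0 leq_add2l; apply: subset_leq_card.
  apply/subsetP => f; rewrite !inE => /andP[-> nf]; rewrite andbT.
  by apply: contraNneq nf => ->; rewrite p0.
have le3 : degree G v <= max_degree G by apply: (@leq_bigmax _ (degree G)).
have := cardsC [set c | missing G psi v c]; rewrite card_ord.
have -> : ~: [set c | missing G psi v c] = [set c | ~~ missing G psi v c].
  by apply/setP => c; rewrite !inE.
lia.
Qed.

Lemma exists_missing psi v : psi e0 = None -> exists c, missing G psi v c.
Proof.
move=> p0; have := card_missing p0 (erefl (if incident G v e0 then 1 else 0)).
by move=> /(leq_ltn_trans (leq0n _)) /card_gt0P[c]; rewrite inE; exists c.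
Qed.

Lemma card_bigcup_missing psi s : uniq s -> elem_seq psi s ->
  #|[set c | has (fun v => missing G psi v c) s]| =
  \sum_(v <- s) #|[set c | missing G psi v c]|.
Proof.
elim: s => [|v s IH] /=.
  by rewrite big_nil => _ _; apply: eq_card0 => c; rewrite inE.
case/andP=> vs us el; rewrite big_cons -IH //; last first.
  by move=> x y c xs ys; apply: el; rewrite inE ?xs ?ys orbT.
rewrite -cardsUI (_ : _ :&: _ = set0) ?cards0 ?addn0.
  by congr #|pred_of_set _|; apply/setP => c; rewrite !inE.
apply/setP => c; rewrite !inE; apply/negP => /andP[mv /hasP[w ws mw]].
have e : v = w by apply: el mv mw; rewrite inE ?eqxx // ws orbT.
by move: vs; rewrite e ws.
Qed.

(** Distinct vertices of an elementary tree miss disjoint sets of colours: at least two colours at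
    each end of [e0], whence the 4, and at least one at each of the [size T] others. *)
Lemma exists_free_colour psi T (L : seq (option 'I_k)) : psi e0 = None ->
  tashkinov_tree G psi e0 T -> elem_seq psi (tverts G e0 T) ->
  size L < size T + 4 ->
  exists c v, [/\ v \in tverts G e0 T, missing G psi v c & Some c \notin L].
Proof.
move=> p0 tT el szL; have := card_bigcup_missing (tree_uniq tT) el.
set M := [set c | _] => cM.
have geM : size T + 4 <= #|M|.
  rewrite cM /tverts /= 2!big_cons.
  have h1 := card_missing (v := src G e0) p0 (erefl _).
  have h2 := card_missing (v := dst G e0) p0 (erefl _).
  rewrite incident_src in h1; rewrite incident_dst in h2.
  have : size T <= \sum_(v <- map fst T) #|[set c | missing G psi v c]|.
    rewrite -(size_map fst) -sum1_size; apply: leq_sum => v _.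
    exact: leq_ltn_trans (card_missing p0 (erefl _)).
  by move=> h3; rewrite addnC; apply: leq_add h1 (leq_add h2 h3).
have : ~~ (M \subset [set c | Some c \in L]).
  apply/negP => /subset_leq_card le.
  suff le2 : #|[set c : 'I_k | Some c \in L]| <= size L.
    by have := leq_trans geM (leq_trans le le2); rewrite leqNgt szL.
  apply: leq_trans (card_size L); rewrite -(card_imset _ (@Some_inj _)).
  by apply: subset_leq_card; apply/subsetP => o /imsetP[c]; rewrite inE => h ->.
case/subsetPn => c; rewrite !inE => /hasP[v vT mv] cL.
by exists c, v.
Qed.

(** * Trees continued by a path *)

Fixpoint tailpath (u : V) P : bool :=
  if P is (v, f) :: P' then joins G f u v && tailpath v P' else true.

(** The first edge is unconstrained: the path may hang from any vertex of the head. *)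
Definition path_tail P := if P is (v, f) :: P' then tailpath v P' else true.

Lemma tree_of_path psi a b u v pre r p : u \in pre -> v \in pre ->
  missing G psi u a -> missing G psi v b -> r \in pre ->
  path (vadj G psi a b) r p -> uniq p -> all (fun x => x \notin pre) p ->
  exists P, [/\ map fst P = p, tailpath r P & tt_ok G psi pre P].
Proof.
move=> up vp mu mv; elim: p pre r up vp => [|w p IH] pre r up vp rp /=.
  by exists [::].
case/andP=> /existsP[f /andP[abf frw]] pp /andP[wp pu] /andP[wpre pall].
have [||||P [P1 P2 P3]] := IH (rcons pre w) w _ _ _ pp pu.
- by rewrite mem_rcons inE up orbT.
- by rewrite mem_rcons inE vp orbT.
- by rewrite mem_rcons mem_head.
- apply/allP => x xp; rewrite mem_rcons inE negb_or (allP pall x xp) andbT.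
  by apply: contraNneq wp => <-.
exists ((w, f) :: P); split => /=; rewrite ?P1 ?frw ?P2 ?P3 // andbT.
apply/tstepP; split => //; first by exists r.
by case/orP: abf => /eqP fc; [exists a, u|exists b, v].
Qed.

(** Follow a chain from [r] to [y] and keep only what comes after its last visit to the tree. *)
Lemma tree_along_comp psi T a b u v r y : tashkinov_tree G psi e0 T ->
  u \in tverts G e0 T -> v \in tverts G e0 T ->
  missing G psi u a -> missing G psi v b -> r \in tverts G e0 T ->
  y \in kcomp G psi a b r ->
  exists P, [/\ path_tail P, tashkinov_tree G psi e0 (T ++ P) &
    y \in tverts G e0 (T ++ P)].
Proof.
move=> tT uT vT mu mv rT; rewrite inE => /connectP[p0 pp0 yl0].
have [n] := ubnP (size p0); elim: n r rT p0 pp0 yl0 => // n IH r rT p0 pp0 yl0.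
rewrite ltnS => szp; case/shortenP: pp0 yl0 szp => p pp up sub yl szp.
have {}szp : size p <= n.
  by apply: leq_trans szp; apply: uniq_leq_size => //; case/andP: up.
case al: (all (fun x => x \notin tverts G e0 T) p); last first.
  (* The chain meets the tree again at [s]: restart from [s] with the shorter remainder. *)
  move/negbT: al; rewrite -has_predC => /hasP[s sp /= /negPn sT].
  case/splitPr: sp pp yl szp {up sub} => p1 p2;
    rewrite cat_path last_cat /= size_cat /=.
  case/and3P=> _ _ pp yl szp; apply: IH sT _ pp yl _; clear -szp; lia.
have [P [P1 P2 P3]] := tree_of_path uT vT mu mv rT pp (proj2 (andP up)) al.
exists P; split.
- by case: P P2 {P1 P3} => [|[w f] P] //= /andP[].
- by rewrite tree_cat tT.
- rewrite tverts_cat mem_cat P1 yl; case: p {pp up sub yl szp al P1} => [|w p] /=.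
    by rewrite rT.
  by rewrite mem_last orbT.
Qed.

End Trees.

(** * Tashkinov's theorem *)

Section Tashkinov.
Variables (V E : finType) (G : graph V E) (k : nat) (e0 : E).
Hypothesis G_loopless : loopless G.
Hypothesis k_large : max_degree G < k.
Variable phi : E -> option 'I_k.
Hypothesis phi_proper : partial_colouring G phi.
Hypothesis phi_e0 : phi e0 = None.
Hypothesis no_common : forall psi, kempe_reach G phi psi ->
  forall c, ~~ (missing G psi (src G e0) c && missing G psi (dst G e0) c).

Implicit Types (psi : E -> option 'I_k) (a b c : 'I_k).

Local Notation reach := (kempe_reach G phi).
Local Notation verts := (tverts G e0).
Local Notation tree psi := (tashkinov_tree G psi e0).

Lemma reach_proper psi : reach psi -> partial_colouring G psi.
Proof. exact: kempe_reach_proper. Qed.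

Lemma reach_e0 psi : reach psi -> psi e0 = None.
Proof. exact: kempe_reach_uncoloured. Qed.

Lemma reach_swap psi a b Z : reach psi -> kempe_closed G psi a b Z ->
  reach (swap G psi a b Z).
Proof. by move=> r cl; apply: kempe_reach_trans r (kempe_reach_swap cl). Qed.

(** [n] bounds the size of the head, while the path tail has any length. With [P] empty this
    contains Tashkinov's theorem. *)
Definition elem_head n := forall (H P : seq (V * E)) psi, size H <= n ->
  reach psi -> tree psi (H ++ P) -> path_tail G P -> elem_seq G psi (verts (H ++ P)).

(** * Moving the colour that the last vertex shares with the tree *)

Section LastVertex.
Variables (n : nat) (T : seq (V * E)) (y : V) (e : E).
Hypothesis IHn : forall m, m < n -> elem_head m.
Hypothesis prefix_elem : forall T1 T2 psi, T = T1 ++ T2 -> reach psi ->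
  tree psi T1 -> elem_seq G psi (verts T1).
(** Beyond the head, of size at most [n], and the first vertex of the tail, each vertex hangs from
    its predecessor. *)
Hypothesis attach : forall T1 w f T2, rcons T (y, e) = T1 ++ (w, f) :: T2 ->
  size T1 <= n \/ exists T0 z g, T1 = rcons T0 (z, g) /\ joins G f z w.

(** In use [T1] is an initial part of [T], to be enlarged to all of [T] by recolouring. *)
Definition shared psi T1 a u :=
  [/\ reach psi /\ tree psi (rcons T (y, e)), missing G psi y a, u \in verts T1,
      missing G psi u a & Some a \notin tcols psi T1].

Lemma last_vertex_notin psi T1 T2 : T = T1 ++ T2 -> tree psi (rcons T (y, e)) ->
  y \notin verts T1.
Proof.
move=> eT; rewrite tree_rcons => /andP[_ /tstepP[ny _ _]]; apply: contra ny.
by rewrite eT mem_tverts_cat => ->.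
Qed.

Lemma tree_prefix psi T1 T2 : T = T1 ++ T2 -> tree psi (rcons T (y, e)) -> tree psi T1.
Proof. by move=> ->; rewrite rcons_cat tree_cat => /andP[]. Qed.

(** Otherwise swapping the component of [u] would keep the tree [T1] and make both [u] and [v] miss
    [b], against elementarity. *)
Lemma linked psi T1 T2 a b u v : T = T1 ++ T2 -> reach psi -> tree psi T1 ->
  Some a \notin tcols psi T1 -> Some b \notin tcols psi T1 ->
  u \in verts T1 -> v \in verts T1 -> missing G psi u a -> missing G psi v b ->
  v \in kcomp G psi a b u.
Proof.
move=> eT r t ua ub uT vT mu mv; apply/negPn/negP => nv.
have cl := kcomp_closed G psi a b u.
have el := prefix_elem eT (reach_swap r cl) (tree_swap_unused cl ua ub t).
have uv : u = v.
  apply: (el u v b) => //; rewrite missing_swap // ?kcomp_refl ?tpermR //.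
  by rewrite (negPf nv).
by move: nv; rewrite uv kcomp_refl.
Qed.

(** The component of [u] already has [u] and [v] as its two ends, or is a single vertex if they
    coincide; a further vertex missing one of the colours does not fit. *)
Lemma not_linked psi T1 T2 a b u v x : T = T1 ++ T2 -> reach psi -> tree psi T1 ->
  Some a \notin tcols psi T1 -> Some b \notin tcols psi T1 ->
  u \in verts T1 -> v \in verts T1 -> missing G psi u a -> missing G psi v b ->
  x \notin verts T1 -> missing G psi x a || missing G psi x b ->
  x \notin kcomp G psi a b u.
Proof.
move=> eT r t ua ub uT vT mu mv xT mx.
have vc := linked eT r t ua ub uT vT mu mv.
have nx w : w \in verts T1 -> x != w by move=> wT; apply: contraNneq xT => ->.
have [uv|nuv] := eqVneq v u.
  by rewrite uv in mv; rewrite kcomp_isolated // inE nx.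
apply/negP => xc; have e1 : v = x.
  by apply: (kcomp_two_ends (reach_proper r) _ _ mx vc xc nuv (nx u uT));
     rewrite ?mu ?mv ?orbT.
by move: (nx v vT); rewrite e1 eqxx.
Qed.

(** The basic move swaps the component of [y]. It avoids [u] and [v], which are linked to each
    other. The edges of [T1] use neither colour, and later edges coloured [a] or [b] still find
    these colours missing at [u] and [v]. *)
Lemma transfer psi T1 T2 a b u v : T = T1 ++ T2 -> shared psi T1 a u -> a != b ->
  v \in verts T1 -> missing G psi v b -> Some b \notin tcols psi T1 ->
  [/\ shared (swap G psi a b (kcomp G psi a b y)) T1 b v,
      u \notin kcomp G psi a b y & v \notin kcomp G psi a b y].
Proof.
move=> eT [[r t] my uT mu ua] nab vT mv ub.
have t1 := tree_prefix eT t; have yT := last_vertex_notin eT t.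
have yu : y \notin kcomp G psi a b u.
  by apply: (not_linked eT r t1 ua ub uT vT mu mv yT); rewrite my.
have vu := linked eT r t1 ua ub uT vT mu mv.
have uy : u \notin kcomp G psi a b y by rewrite kcomp_sym.
have vy : v \notin kcomp G psi a b y.
  by rewrite kcomp_sym; apply: contra yu; apply: kcomp_trans vu.
have cl := kcomp_closed G psi a b y.
split => //; split => //.
- split; first exact: reach_swap.
  move: t; rewrite eT rcons_cat !tree_cat => /andP[_ t2].
  rewrite (tree_swap_unused cl ua ub t1) /=.
  exact: (tt_ok_swap_missing cl uT vT uy vy mu mv t2).
- by rewrite missing_swap // kcomp_refl tpermR.
- by rewrite missing_swap_notin.
- by rewrite swap_tcols_unused.
Qed.

Lemma shared_next psi T1 a u w f : shared psi T1 a u -> psi f <> Some a ->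
  shared psi (rcons T1 (w, f)) a u.
Proof.
move=> [rt my uT mu ua] fa; split => //; first by rewrite mem_tverts_rcons uT orbT.
by rewrite tcols_rcons mem_rcons in_cons negb_or ua andbT eq_sym; apply/eqP.
Qed.

(** As the parent [r] misses [b], it lies outside the component of [y]. The swap leaves [f] coloured
    [a], while the shared colour becomes [b]. *)
Lemma climb_parent psi T1 T2 a b u w f r : T = T1 ++ (w, f) :: T2 ->
  shared psi T1 a u -> psi f = Some a -> r \in verts T1 -> joins G f r w ->
  missing G psi r b -> Some b \notin tcols psi T1 ->
  exists psi' a' u', shared psi' (rcons T1 (w, f)) a' u'.
Proof.
move=> eT sh fa rT fr mr ub.
have nab : a != b by apply: contraTneq mr => <-;
  rewrite (has_col_not_missing (joins_incidentl fr) fa).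
have [sh' _ ny] := transfer eT sh nab rT mr ub.
eexists; exists b, r; apply: shared_next sh' _.
rewrite (swap_notin (kcomp_closed _ _ _ _ _) (joins_incidentl fr) ny) fa => -[ab].
by rewrite ab eqxx in nab.
Qed.

(* If the swap moves [f], then the (a,b)-chain from [y] meets [T0], and following it
   yields a tree with the smaller head [T0] containing both [u] and [y]. *)
Lemma climb_low psi T0 z g T2 a u w f r :
  T = rcons T0 (z, g) ++ (w, f) :: T2 -> size T0 < n ->
  shared psi (rcons T0 (z, g)) a u -> u \in verts T0 ->
  psi f = Some a -> r \in verts T0 -> joins G f r w ->
  exists psi' a' u', shared psi' (rcons (rcons T0 (z, g)) (w, f)) a' u'.
Proof.
move=> eT sz sh uT fa rT fr; have [[re t] my _ mu ua] := sh.
have eT0 : T = T0 ++ (z, g) :: (w, f) :: T2 by rewrite eT cat_rcons.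
have t0 := tree_prefix eT0 t.
have [||b [v [vT mv]]] := exists_free_colour G_loopless k_large
    (L := Some a :: tcols psi (rcons T0 (z, g))) (reach_e0 re) t0.
- exact: prefix_elem eT0 re t0.
- by rewrite /= tcols_rcons size_rcons !size_map; lia.
rewrite in_cons negb_or => /andP[nba ub].
have nab : a != b by apply: contraNneq nba => ->.
have vT1 : v \in verts (rcons T0 (z, g)) by rewrite mem_tverts_rcons vT orbT.
have [sh' _ _] := transfer eT sh nab vT1 mv ub.
have [fb|nfb] := eqVneq (swap G psi a b (kcomp G psi a b y) f) (Some b); last first.
  by eexists; exists b, v; apply: shared_next sh' _; apply/eqP.
have ry : r \in kcomp G psi a b y.
  apply: contraNT nab => /(swap_notin (kcomp_closed _ _ _ _ _) (joins_incidentl fr)).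
  by rewrite fb fa => -[->].
rewrite kcomp_sym in ry.
have [P [P1 P2 P3]] := tree_along_comp t0 uT vT mu mv rT ry.
have el := IHn sz (leqnn _) re P2 P1.
have uy : u = y by apply: (el u y a) => //; rewrite mem_tverts_cat uT.
by move: (last_vertex_notin eT0 t); rewrite -uy uT.
Qed.

Lemma climb psi T1 T2 a u w f : T = T1 ++ (w, f) :: T2 -> shared psi T1 a u ->
  exists psi' a' u', shared psi' (rcons T1 (w, f)) a' u'.
Proof.
move=> eT sh; have [[re t] my uT mu ua] := sh.
have t1 := tree_prefix eT t; have el1 := prefix_elem eT re t1.
have [fa|nfa] := eqVneq (psi f) (Some a); last first.
  by exists psi, a, u; apply: shared_next sh _; apply/eqP.
have [_ [r rT fr] _] : [/\ w \notin verts T1, exists2 r, r \in verts T1 &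
  joins G f r w & True].
  have : tree psi (rcons T1 (w, f)).
    by apply: (tree_prefix (T2 := T2)) t; rewrite cat_rcons.
  by rewrite tree_rcons => /andP[_ /tstepP[]].
have attT : rcons T (y, e) = T1 ++ (w, f) :: rcons T2 (y, e) by rewrite eT rcons_cat.
have last_case T0 z g : T1 = rcons T0 (z, g) -> joins G f z w ->
    exists psi' a' u', shared psi' (rcons T1 (w, f)) a' u'.
  move=> e1 fz; have [b mb] := exists_missing k_large z (reach_e0 re).
  apply: (climb_parent eT sh fa _ fz mb); first by rewrite e1 mem_tverts_rcons eqxx.
  by rewrite e1 in t1 el1 *; apply: last_unused t1 el1 mb.
case: (attach attT) => [sz|[T0 [z [g [e1 fz]]]]]; last exact: last_case e1 fz.
case/lastP eT1: T1 => [|T0 [z g]].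
  have [b mb] := exists_missing k_large r (reach_e0 re).
  by rewrite -eT1; apply: (climb_parent eT sh fa rT fr mb); rewrite eT1.
have [rz|nrz] := eqVneq r z; first by rewrite -eT1; apply: last_case eT1 _; rewrite -rz.
rewrite eT1 in eT sh t1 el1 rT sz uT ua.
have {}sz : size T0 < n by rewrite size_rcons in sz.
have {nrz}rT0 : r \in verts T0 by move: rT; rewrite mem_tverts_rcons (negPf nrz).
case uT0: (u \in verts T0); first exact: (climb_low eT sz sh uT0 fa rT0 fr).
(* Here [u] is [z]. Move the shared colour to a vertex [v] of [T0]: either [f] avoids the new
   colour, or [climb_low] applies to it. *)
have eT0 : T = T0 ++ (z, g) :: (w, f) :: T2 by rewrite eT cat_rcons.
have t0 := tree_prefix eT0 t.
have [||b [v [vT mv]]] := exists_free_colour G_loopless k_large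
    (L := Some a :: tcols psi (rcons T0 (z, g))) (reach_e0 re) t0.
- exact: prefix_elem eT0 re t0.
- by rewrite /= tcols_rcons size_rcons !size_map; lia.
rewrite in_cons negb_or => /andP[nba ub].
have nab : a != b by apply: contraNneq nba => ->.
have vT1 : v \in verts (rcons T0 (z, g)) by rewrite mem_tverts_rcons vT orbT.
have [sh' _ _] := transfer eT sh nab vT1 mv ub.
have [fb|nfb] := eqVneq (swap G psi a b (kcomp G psi a b y) f) (Some b); last first.
  by eexists; exists b, v; apply: shared_next sh' _; apply/eqP.
exact: (climb_low eT sz sh' vT fb rT0 fr).
Qed.

Lemma climb_all T1 T2 psi a u : T = T1 ++ T2 -> shared psi T1 a u ->
  exists psi' a' u', shared psi' T a' u'.
Proof.
elim: T2 T1 psi a u => [|[w f] T2 IH] T1 psi a u eT sh.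
  by exists psi, a, u; rewrite eT cats0.
have [psi' [a' [u' sh']]] := climb eT sh.
by apply: IH sh'; rewrite cat_rcons.
Qed.

(** A transfer to a prescribed colour that keeps the colour [c] of [e] and all vertices missing [c];
    [c] differs from [a] because [y] misses [a]. *)
Lemma share_with psi a u b v c : shared psi T a u -> v \in verts T ->
  missing G psi v b -> Some b \notin tcols psi T -> psi e = Some c -> c != b ->
  exists psi', [/\ shared psi' T b v, psi' e = Some c &
    forall x, missing G psi x c -> missing G psi' x c].
Proof.
move=> sh vT mv ub ec ncb; have eT : T = T ++ [::] by rewrite cats0.
have [[re t] my uT mu ua] := sh.
have [ab|nab] := eqVneq a b.
  by exists psi; split => //; split => //; rewrite -ab.
have [_ /tstepP[_ [r _ er] _]] : tree psi T /\ tstep G psi (verts T) y e.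
  by move: t; rewrite tree_rcons => /andP[].
have nca : c != a.
  by apply: contraTneq my => <-; rewrite (has_col_not_missing (joins_incidentr er) ec).
have [sh' _ _] := transfer eT sh nab vT mv ub.
exists (swap G psi a b (kcomp G psi a b y)); split => //.
  by apply/eqP; rewrite swap_colD // ec.
by move=> x; rewrite missing_swapD //; apply: kcomp_closed.
Qed.

Lemma shared_parent_absurd psi a u b r : shared psi T a u -> r \in verts T ->
  joins G e r y -> missing G psi r b -> Some b \notin tcols psi T -> False.
Proof.
move=> sh rT er mr ub; have eT : T = T ++ [::] by rewrite cats0.
have [[re t] my uT mu ua] := sh.
have [_ [_ _ [c [h [ec hT mh]]]]] : tree psi T /\
   [/\ y \notin verts T, exists2 r, r \in verts T & joins G e r y
    & exists c x, [/\ psi e = Some c, x \in verts T & missing G psi x c]].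
  by move: t; rewrite tree_rcons => /andP[? /tstepP].
have re_ := joins_incidentl er; have ye := joins_incidentr er.
have ncb : c != b by apply: contraTneq mr => <-; rewrite (has_col_not_missing re_ ec).
have [psi1 [sh1 ec1 mc1]] := share_with sh rT mr ub ec ncb.
move: {mh}(mc1 h mh) => mh; have {re t my uT mu ua mr ub sh}[[re t] my _ mr ub] := sh1.
have pr := reach_proper re; have yT := last_vertex_notin eT t.
set Z := [set r; y].
have Ze v : v \in Z -> incident G v e by rewrite !inE => /orP[]/eqP->.
have mZ v : v \in Z -> missing G psi1 v b by rewrite !inE => /orP[]/eqP->.
have Zc f v : v \in Z -> incident G v f -> psi1 f = Some c -> f = e.
  by move=> vZ vf fc; apply: (proper_inj pr vf (Ze v vZ) fc ec1).
have Zb f v : v \in Z -> incident G v f -> psi1 f <> Some b.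
  by move=> vZ; apply: missingP (mZ v vZ).
have eZ v : incident G v e -> v \in Z.
  by move=> /(joins_incident er); rewrite !inE.
have cl : kempe_closed G psi1 c b Z.
  have half f v w : bicol psi1 c b f -> v \in Z -> incident G v f ->
      incident G w f -> w \in Z.
    move=> /orP[]/eqP fc vZ vf wf; last by case: (Zb f v).
    by apply: eZ; rewrite -(Zc f v).
  move=> f fc; apply/idP/idP => h1.
    exact: half fc h1 (incident_src G f) (incident_dst G f).
  exact: half fc h1 (incident_dst G f) (incident_src G f).
have hr : h != r.
  by apply: contraTneq mh => ->; rewrite (has_col_not_missing re_ ec1).
have hy : h != y by apply: contraNneq yT => <-.
have t1 := tree_prefix eT t.
have el := prefix_elem eT (reach_swap re cl).
suff t2 : tree (swap G psi1 c b Z) T.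
  have /eqP : h = r.
    apply: (el t2 h r c) => //; rewrite missing_swap //.
      by rewrite !inE (negPf hr) (negPf hy).
    by rewrite !inE eqxx tpermL.
  by rewrite (negPf hr).
apply: tt_ok_agree (t1) => [f fT|x d xT dT mx].
  rewrite /swap; case: ifP => // sZ; apply: omap_tperm_id.
  apply/norP; split; apply/eqP; last exact: Zb sZ (incident_src G f).
  move=> /(Zc f _ sZ (incident_src G f)) fe; rewrite fe in fT.
  by move: yT; rewrite (tree_edges t1 fT ye).
rewrite missing_swap //; case: ifP => // xZ.
have nbd : b != d by apply: contraNneq ub => ->.
rewrite tpermD //; apply: contraTneq mx => <-.
by rewrite (has_col_not_missing (Ze _ xZ) ec1).
Qed.

Lemma shared_low_absurd psi T0 z g a u r c h : T = rcons T0 (z, g) -> size T0 < n ->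
  shared psi T a u -> r \in verts T0 -> joins G e r y -> psi e = Some c ->
  h \in verts T0 -> missing G psi h c -> False.
Proof.
move=> eT sz sh rT er ec hT mh; have [[re t] my _ _ _] := sh.
have eT0 : T = T0 ++ [:: (z, g)] by rewrite eT cats1.
have t0 := tree_prefix eT0 t.
have [||b [v [vT mv]]] := exists_free_colour G_loopless k_large
    (L := Some c :: tcols psi T) (reach_e0 re) t0.
- exact: prefix_elem eT0 re t0.
- by rewrite /= !size_map eT size_rcons; lia.
rewrite in_cons negb_or => /andP[nbc ub].
have ncb : c != b by apply: contraNneq nbc => ->.
have vT1 : v \in verts T by rewrite eT mem_tverts_rcons vT orbT.
have [psi1 [[[re1 t1] my1 _ mv1 _] ec1 mc1]] := share_with sh vT1 mv ub ec ncb.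
have yT0 := last_vertex_notin eT0 t1.
have t2 : tree psi1 (T0 ++ [:: (y, e)]).
  rewrite cats1 tree_rcons (tree_prefix eT0 t1); apply/tstepP; split => //.
    by exists r.
  by exists c, h; split => //; apply: mc1.
have el := IHn sz (leqnn _) re1 t2 isT.
have vy : v = y.
  by apply: (el v y b) => //; rewrite cats1 mem_tverts_rcons ?eqxx // vT orbT.
by rewrite -vy vT in yT0.
Qed.

Lemma shared_absurd psi a u : shared psi T a u -> False.
Proof.
move=> sh; have [[re t] my uT mu ua] := sh.
have eT : T = T ++ [::] by rewrite cats0.
have t1 := tree_prefix eT t; have el1 := prefix_elem eT re t1.
have [_ [yT [r rT er] [c [h [ec hT mh]]]]] : tree psi T /\
   [/\ y \notin verts T, exists2 r, r \in verts T & joins G e r y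
    & exists c x, [/\ psi e = Some c, x \in verts T & missing G psi x c]].
  by move: t; rewrite tree_rcons => /andP[? /tstepP].
have attT : rcons T (y, e) = T ++ (y, e) :: [::] by rewrite cats1.
have last_case T0 z g : T = rcons T0 (z, g) -> joins G e z y -> False.
  move=> e1 ez; have [b mb] := exists_missing k_large z (reach_e0 re).
  apply: (shared_parent_absurd sh _ ez mb); first by rewrite e1 mem_tverts_rcons eqxx.
  by move: t1 el1; rewrite e1 => t1 el1; apply: last_unused t1 el1 mb.
case: (attach attT) => [sz|[T0 [z [g [e1 fz]]]]]; last exact: last_case e1 fz.
case/lastP eT1: T => [|T0 [z g]].
  have [b mb] := exists_missing k_large r (reach_e0 re).
  by apply: (shared_parent_absurd sh rT er mb); rewrite eT1.
have [rz|nrz] := eqVneq r z; first by apply: last_case eT1 _; rewrite -rz.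
have rT0 : r \in verts T0 by move: rT; rewrite eT1 mem_tverts_rcons (negPf nrz).
have {}sz : size T0 < n by rewrite eT1 size_rcons in sz.
case hT0: (h \in verts T0); first exact: shared_low_absurd eT1 sz sh rT0 er ec hT0 mh.
(* The colour [c] of [e] is missing at [z]. Let [y] share a colour [b] with some [v] in [T0], then
   swap [b] and [c] on the component joining [v] to [z]: now [v] misses [c], and [z] shares [b] with
   [y]. *)
have hz : h = z by apply/eqP; move: hT; rewrite eT1 mem_tverts_rcons hT0 orbF.
rewrite {h hT hT0}hz in mh.
have eT0 : T = T0 ++ [:: (z, g)] by rewrite eT1 cats1.
have t0 := tree_prefix eT0 t.
have [||b [v [vT mv]]] := exists_free_colour G_loopless k_large
    (L := Some c :: tcols psi T) (reach_e0 re) t0.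
- exact: prefix_elem eT0 re t0.
- by rewrite /= !size_map eT1 size_rcons; lia.
rewrite in_cons negb_or => /andP[nbc ub].
have ncb : c != b by apply: contraNneq nbc => ->.
have vT1 : v \in verts T by rewrite eT1 mem_tverts_rcons vT orbT.
have [psi1 [sh1 ec1 mc1]] := share_with sh vT1 mv ub ec ncb.
have {sh re t my uT mu ua t1 el1 mv ub t0}[[re t] my _ mv ub] := sh1.
have {}mh := mc1 _ mh; have t1 := tree_prefix eT t; have el1 := prefix_elem eT re t1.
have zT : z \in verts T by rewrite eT1 mem_tverts_rcons eqxx.
have uc : Some c \notin tcols psi1 T.
  by move: t1 el1; rewrite eT1 => t1 el1; apply: last_unused t1 el1 mh.
have zv := linked eT re t1 ub uc vT1 zT mv mh.
have yv : y \notin kcomp G psi1 b c v.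
  by apply: (not_linked eT re t1 ub uc vT1 zT mv mh yT); rewrite my.
have cl := kcomp_closed G psi1 b c v.
have ec2 : swap G psi1 b c (kcomp G psi1 b c v) e = Some c.
  by rewrite (swap_notin cl (joins_incidentr er) yv).
have mv2 : missing G (swap G psi1 b c (kcomp G psi1 b c v)) v c.
  by rewrite missing_swap // kcomp_refl tpermR.
apply: (@shared_low_absurd (swap G psi1 b c (kcomp G psi1 b c v)) T0 z g b z r c v) =>
  //.
split => //; last by rewrite swap_tcols_unused.
- split; first exact: reach_swap.
  rewrite tree_rcons (tree_swap_unused cl ub uc t1); apply/tstepP; split => //.
    by exists r.
  by exists c, v.
- by rewrite missing_swap_notin.
- by rewrite missing_swap // zv tpermL.
Qed.

End LastVertex.

Lemma tailpath_cat u (P1 P2 : seq (V * E)) : tailpath G u (P1 ++ P2) =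
  tailpath G u P1 && tailpath G (last u (map fst P1)) P2.
Proof. by elim: P1 u => [|[v f] P1 IH] u //=; rewrite IH andbA. Qed.

Lemma path_tail_catl (P1 P2 : seq (V * E)) : path_tail G (P1 ++ P2) -> path_tail G P1.
Proof. by case: P1 => [|[v f] P1] //=; rewrite tailpath_cat => /andP[]. Qed.

Lemma path_tail_attach (P1 P2 : seq (V * E)) z g w f :
  path_tail G (rcons P1 (z, g) ++ (w, f) :: P2) -> joins G f z w.
Proof.
rewrite cat_rcons; case: P1 => [|[v h] P1] /=; first by case/andP.
by rewrite tailpath_cat /= => /and4P[].
Qed.

Lemma elem_headP n : elem_head n.
Proof.
elim/ltn_ind: n => n IHn.
(* With an empty tail, the last vertex of the head is read as a tail of length one behind a shorter
   head; [no_common] settles the empty tree. *)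
have el0 H psi : size H <= n -> reach psi -> tree psi H -> elem_seq G psi (verts H).
  case/lastP: H => [|H [z g]] sz re t.
    move=> x w c; rewrite !in_cons !in_nil !orbF => xs ws mx mw.
    have := no_common re c.
    case/orP: xs mx => /eqP -> mx; case/orP: ws mw => /eqP -> mw //; by rewrite mx mw.
  rewrite size_rcons in sz; rewrite -cats1 in t *.
  exact: IHn sz _ _ _ (leqnn _) re t isT.
move=> H P psi szH; have [m] := ubnP (size P); elim: m P psi => // m IHm P psi.
rewrite ltnS; case/lastP: P => [|P [y e]] szP re t pt; first by rewrite !cats0 in t *;
  apply: el0.
have ptP : path_tail G P by move: pt; rewrite -cats1; apply: path_tail_catl.
rewrite size_rcons in szP; rewrite -rcons_cat in t *.
have prefix_elem T1 T2 psi' : H ++ P = T1 ++ T2 -> reach psi' -> tree psi' T1 ->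
    elem_seq G psi' (verts T1).
  move=> eT re'; have eT1 : T1 = take (size T1) (H ++ P) by rewrite eT take_size_cat.
  rewrite eT1 take_cat; case: ltnP => szT t'.
    by apply: el0 => //; rewrite size_take szT; lia.
  apply: IHm t' _ => //; first by rewrite size_take_min; lia.
  by move: ptP; rewrite -{1}(cat_take_drop (size T1 - size H) P); apply: path_tail_catl.
have attach T1 w f T2 : rcons (H ++ P) (y, e) = T1 ++ (w, f) :: T2 ->
    size T1 <= n \/ exists T0 z g, T1 = rcons T0 (z, g) /\ joins G f z w.
  move=> eT; case: (leqP (size T1) n) => szT1; [by left | right].
  have eT1 : T1 = take (size T1) (H ++ rcons P (y, e)).
    by rewrite -rcons_cat eT take_size_cat.
  move: eT1; rewrite take_cat; case: ltnP => [|szT]; first by lia.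
  set P1 := take _ _ => eT1; have : rcons P (y, e) = P1 ++ (w, f) :: T2.
    by move/eqP: eT; rewrite rcons_cat eT1 -catA eqseq_cat // eqxx => /eqP.
  case/lastP eP1: P1 => [|P0 [z g]] eP.
    by move: szT1; rewrite eT1 eP1 cats0; lia.
  exists (H ++ P0), z, g; rewrite eT1 eP1 rcons_cat; split => //.
  by rewrite eP in pt; apply: path_tail_attach pt.
have elT : elem_seq G psi (verts (H ++ P)).
  by apply: (prefix_elem (H ++ P) [::]); rewrite ?cats0 //; move: t;
    rewrite tree_rcons => /andP[].
have noshare u c : u \in verts (H ++ P) -> missing G psi u c -> missing G psi y c ->
  False.
  move=> uT mu my.
  (* The starting part [T1] is empty if [u] is an end of [e0], and otherwise is the tree up to [u],
     where [last_unused] applies. *)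
  suff [T1 [T2 [eT uT1 uc]]] : exists T1 T2, [/\ H ++ P = T1 ++ T2, u \in verts T1
      & Some c \notin tcols psi T1].
    have sh : shared (H ++ P) y e psi T1 c u by split.
    have [psi' [c' [u' sh']]] := climb_all IHn prefix_elem attach eT sh.
    exact: shared_absurd IHn prefix_elem attach _ _ _ sh'.
  move: (uT); rewrite {1}/tverts mem_cat => /orP[u0|/mapP[[u' g] gT /= eu]].
    by exists [::], (H ++ P); rewrite /tverts cats0.
  case/splitPr eT: _ / gT => [T1 T2]; exists (rcons T1 (u', g)), T2.
  have e1 : H ++ P = rcons T1 (u', g) ++ T2 by rewrite eT cat_rcons.
  split; [by rewrite cat_rcons|by rewrite mem_tverts_rcons eu eqxx|].
  have t1 : tree psi (rcons T1 (u', g)).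
    by move: t; rewrite e1 rcons_cat tree_cat => /andP[].
  by apply: last_unused t1 (prefix_elem _ _ _ e1 re t1) _; rewrite -eu.
move=> x w c; rewrite !mem_tverts_rcons => /orP[/eqP->|xT] /orP[/eqP->|wT] // mx mw.
- by case: (noshare w c).
- by case: (noshare x c).
- exact: elT mx mw.
Qed.

Theorem tashkinov psi T : reach psi -> tree psi T -> elem_seq G psi (verts T).
Proof.
move=> re t; have := elem_headP (n := size T) (H := T) (P := [::]) (leqnn _) re.
by rewrite cats0 => h; apply: h.
Qed.

End Tashkinov.

(** * Maximal trees and defective colours *)

Section Closure.
Variables (V E : finType) (G : graph V E) (k : nat) (e0 : E).
Implicit Types (psi : E -> option 'I_k) (T : seq (V * E)).

Lemma W_step_mono psi : {homo W_step G psi e0 : X Y / X \subset Y}.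
Proof.
move=> X Y /subsetP sXY; apply: setUS; apply/subsetP => v; rewrite !in_set.
case/existsP=> f /existsP[c /and3P[fc /existsP[u /andP[uX fu]] /existsP[x /andP[xX
  mx]]]].
apply/existsP; exists f; apply/existsP; exists c; rewrite fc /=; apply/andP; split.
  by apply/existsP; exists u; rewrite sXY.
by apply/existsP; exists x; rewrite sXY.
Qed.

Lemma W_fix psi : W_step G psi e0 (W G psi e0) = W G psi e0.
Proof. by rewrite /W fixsetK //; apply: W_step_mono. Qed.

Lemma W_closed psi c x f u v : x \in W G psi e0 -> missing G psi x c ->
  psi f = Some c -> joins G f u v -> (u \in W G psi e0) = (v \in W G psi e0).
Proof.
move=> xW mx fc.
have half s t : joins G f s t -> s \in W G psi e0 -> t \in W G psi e0.
  move=> fst_ sW; rewrite -W_fix in_setU; apply/orP; right; rewrite in_set.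
  apply/existsP; exists f; apply/existsP; exists c; rewrite fc eqxx /=.
  by apply/andP; split; apply/existsP; [exists s; rewrite sW|exists x; rewrite xW].
by move=> fuv; apply/idP/idP; apply: half; rewrite // joinsC.
Qed.

Lemma tree_sub_W psi T : tashkinov_tree G psi e0 T ->
  {subset tverts G e0 T <= W G psi e0}.
Proof.
elim/last_ind: T => [|T [v f] IH].
  move=> _ x; rewrite -W_fix !inE => /orP[]/eqP->; by rewrite eqxx ?orbT.
rewrite tree_rcons => /andP[/IH sub /tstepP[_ [r rT fr] [c [y [fc yT my]]]]] x.
rewrite mem_tverts_rcons => /orP[/eqP->|/sub //].
by rewrite -(W_closed (sub _ yT) my fc fr) sub.
Qed.

Lemma max_tree_W psi T : max_tashkinov_tree G psi e0 T ->
  W G psi e0 = [set v in tverts G e0 T].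
Proof.
case/andP=> tT /forallP mT; apply/eqP; rewrite eqEsubset; apply/andP; split; last first.
  by apply/subsetP => v; rewrite in_set; apply: tree_sub_W.
(* [fixset] iterates [W_step] from the empty set; no iterate leaves the tree, because the tree
   admits no further step. *)
rewrite /W /fixset; elim: #|V| => [|n IH] /=; first by rewrite sub0set.
apply/subsetP => v; rewrite in_setU => /orP[].
  by rewrite in_set2 in_set /tverts /= !in_cons => /orP[]->; rewrite ?orbT.
rewrite !in_set => /existsP[f /existsP[c /and3P[/eqP fc]]].
case/existsP=> u /andP[uI fuv] /existsP[x /andP[xI mx]].
have /forallP/(_ f) := mT v; apply: contraR => nv.
have sub := subsetP IH; apply/tstepP; split => //.
  by exists u => //; have := sub u uI; rewrite in_set.
by exists c, x; split => //; have := sub x xI; rewrite in_set.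
Qed.

End Closure.

Lemma all_take_find (A : Type) (p : pred A) s : all (predC p) (take (find p s) s).
Proof. by elim: s => //= x s IH; case: ifP => //= ->. Qed.

(** * Recolourings that preserve the maximal tree *)

Section Main.
Variables (V E : finType) (G : graph V E) (k : nat) (e0 : E).
Hypothesis G_loopless : loopless G.
Hypothesis k_large : max_degree G < k.
Variables (phi : E -> option 'I_k) (T : seq (V * E)).
Hypothesis phi_proper : partial_colouring G phi.
Hypothesis phi_e0 : phi e0 = None.
Hypothesis T_max : max_tashkinov_tree G phi e0 T.
Hypothesis no_common : forall psi, kempe_reach G phi psi ->
  forall c, ~~ (missing G psi (src G e0) c && missing G psi (dst G e0) c).
Hypothesis W_max : forall psi, kempe_reach G phi psi ->
  #|W G psi e0| <= #|W G phi e0|.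
Implicit Types (psi : E -> option 'I_k) (a b c d : 'I_k) (Z : {set V}).

Local Notation reach := (kempe_reach G phi).
Local Notation W0 := (W G phi e0).

Definition good psi := reach psi /\ tashkinov_tree G psi e0 T.

Lemma phi_good : good phi.
Proof. by split; [apply: kempe_refl | case/andP: T_max]. Qed.

Lemma mem_W0 v : (v \in W0) = (v \in tverts G e0 T).
Proof. by rewrite (max_tree_W T_max) in_set. Qed.

Lemma good_W psi : good psi -> W G psi e0 = W0.
Proof.
case=> re t; apply/esym/eqP; rewrite eqEcard W_max // andbT.
by apply/subsetP => v; rewrite mem_W0; apply: tree_sub_W t _.
Qed.

Lemma good_proper psi : good psi -> partial_colouring G psi.
Proof. by case=> re _; apply: kempe_reach_proper re. Qed.

Lemma good_missing psi v : good psi -> exists c, missing G psi v c.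
Proof.
case=> re _; have p0 := kempe_reach_uncoloured phi_e0 re.
exact (exists_missing k_large v p0).
Qed.

Lemma good_elem psi x y c : good psi -> x \in W0 -> y \in W0 ->
  missing G psi x c -> missing G psi y c -> x = y.
Proof.
rewrite !mem_W0 => -[re t].
exact: (tashkinov G_loopless k_large phi_proper phi_e0 no_common re t).
Qed.

Lemma good_closed psi x c f u v : good psi -> x \in W0 -> missing G psi x c ->
  psi f = Some c -> joins G f u v -> (u \in W0) = (v \in W0).
Proof. by move=> gd; rewrite -(good_W gd); apply: W_closed. Qed.

Lemma crossing_joins (X : {set V}) f u v : joins G f u v ->
  crossing G X f = ((u \in X) != (v \in X)).
Proof. by rewrite /crossing => /orP[]/andP[/eqP-> /eqP->] //; rewrite eq_sym. Qed.

Lemma good_not_crossing psi x c f : good psi -> x \in W0 -> missing G psi x c ->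
  psi f = Some c -> crossing G W0 f = false.
Proof.
move=> gd xW mx fc; rewrite /crossing.
by rewrite (good_closed gd xW mx fc (joins_srcdst G f)) eqxx.
Qed.

Lemma crossing_end f : crossing G W0 f ->
  exists u v, [/\ u \in W0, v \notin W0 & joins G f u v].
Proof.
rewrite /crossing; case s: (src G f \in W0); case d: (dst G f \in W0) => // _.
  by exists (src G f), (dst G f); rewrite s d joins_srcdst.
by exists (dst G f), (src G f); rewrite s d joinsC joins_srcdst.
Qed.

Lemma tree_edge_W f v : f \in map snd T -> incident G v f -> v \in W0.
Proof.
by rewrite mem_W0 => fT vf; case/andP: T_max => t _; apply: tree_edges t fT vf.
Qed.

Lemma good_unused psi c : good psi -> (forall y, y \in W0 -> ~~ missing G psi y c) ->
  Some c \notin tcols psi T.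
Proof.
move=> [re t] nm; apply/negP => /tcolsP[f fT fc].
have [d [x [fd xT mx]]] := tree_cols t fT.
have dc : d = c by move: fc; rewrite fd => -[].
by move: (nm x); rewrite mem_W0 xT -dc mx => /(_ isT).
Qed.

Lemma good_swap psi c d Z : good psi -> kempe_closed G psi c d Z ->
  tashkinov_tree G (swap G psi c d Z) e0 T -> good (swap G psi c d Z).
Proof. by move=> [re _] cl t; split => //; apply: reach_swap. Qed.

Lemma good_swap_out psi c d Z : good psi -> kempe_closed G psi c d Z ->
  [disjoint Z & W0] -> good (swap G psi c d Z).
Proof.
move=> gd cl dis; apply: good_swap => //; case: gd => _ t.
apply: tt_ok_agree (t) => [f fT|x c' xT _].
  by apply: (swap_notin cl (incident_src G f));
     rewrite (disjointFl dis) // (tree_edge_W fT) // incident_src.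
by rewrite missing_swap_notin // (disjointFl dis) // mem_W0.
Qed.

(** No edge with a colour missing in [W0] crosses its boundary. Hence swapping on all of [W0] merely
    renames two missing colours inside it. *)
Lemma W_kempe_closed psi b c x y : good psi -> x \in W0 -> y \in W0 ->
  missing G psi x b -> missing G psi y c -> kempe_closed G psi b c W0.
Proof.
move=> gd xW yW mx my f /orP[]/eqP fc; apply: (good_closed gd _ _ fc) => //.
- exact: xW.
- exact: mx.
- exact: joins_srcdst.
- exact: yW.
- exact: my.
- exact: joins_srcdst.
Qed.

Lemma good_swap_in psi b c : good psi -> kempe_closed G psi b c W0 ->
  good (swap G psi b c W0).
Proof.
move=> gd cl; apply: good_swap => //; case: gd => _ t.
apply: tt_ok_impl (t) => f d fT fd; exists (tperm b c d).
  by rewrite /swap (tree_edge_W fT) ?incident_src // fd.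
move=> s _ sT /hasP[x xs mx]; apply/hasP; exists x => //.
have xW : x \in W0 by rewrite mem_W0; apply: sT.
by rewrite missing_swap // xW tpermK.
Qed.

Section Probe.
Variables (x : V).
Hypothesis xW : x \in W0.

Definition exposed psi b := [/\ good psi, missing G psi x b &
  Some b \notin tcols psi T].

Definition avoids psi a := forall y, y \in W0 -> ~~ missing G psi y a.

(* Otherwise swapping the component makes [a] missing in [W] while some edge
   coloured [a] still leaves [W]. *)
Lemma crossing_in_comp psi a b f : exposed psi b -> avoids psi a ->
  psi f = Some a -> crossing G W0 f -> src G f \in kcomp G psi a b x.
Proof.
move=> [gd mx ub] na fa cf; apply/negPn/negP => nf.
have cl := kcomp_closed G psi a b x; have ua := good_unused gd na.
have gd' : good (swap G psi a b (kcomp G psi a b x)).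
  by apply: good_swap => //; case: gd => _; apply: tree_swap_unused.
have mx' : missing G (swap G psi a b (kcomp G psi a b x)) x a.
  by rewrite missing_swap // kcomp_refl tpermL.
have := good_not_crossing gd' xW mx' _ (f := f); rewrite cf => /(_ _)/negP; apply => //.
by rewrite (swap_notin cl (incident_src G f)).
Qed.

(** The situation of (b), stated for any colouring so that it can be followed through
    recolourings. *)
Definition probe psi a b :=
  [/\ exposed psi b, avoids psi a & 1 < #|crossing_col G psi W0 a|].

(** If the last vertex missed a colour, the walk would fill the component of [x]. Its only crossing
    edge is the first edge of [p2], whereas that component contains all crossing edges coloured [a],
    of which there are several. *)
Lemma probe_return psi a b (p1 p2 : seq (E * V)) : probe psi a b ->
  alt_walk G psi a b x (p1 ++ p2) -> {subset x :: map snd p1 <= W0} -> p2 != [::] ->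
  (forall v, v \in map snd p2 -> v \notin W0) ->
  ~~ missing G psi (last x (map snd (p1 ++ p2))) a /\
  ~~ missing G psi (last x (map snd (p1 ++ p2))) b.
Proof.
move=> [ex na two] w in1 np2 out2; have [gd mx ub] := ex.
set l := last x _.
have np : p1 ++ p2 != [::] by case: (p1).
have hl := alt_walk_last_has w np; rewrite -/l in hl.
suff hn : ~~ missing G psi l (if odd (size (p1 ++ p2)) then b else a).
  by move: hl hn; case: (odd _).
apply/negP => ml.
have cl : kempe_closed G psi a b [set v in x :: map snd (p1 ++ p2)].
  apply: alt_walk_closed => //; first exact: good_proper.
  by move=> f v /joins_incidentl lf fc; case: (missingP ml lf).
case: p2 np2 out2 w np l hl ml cl => // -[e1 w1] p2 _ out2 w _ l hl ml cl.
suff sub : crossing_col G psi W0 a \subset [set e1].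
  by have := subset_leq_card sub; rewrite cards1 leqNgt two.
apply/subsetP => f; rewrite !in_set => /andP[/eqP fa cf].
have sf := crossing_in_comp ex na fa cf.
have [u [v [uW vW fuv]]] := crossing_end cf.
have abf := bicol_l b fa.
have uc : u \in x :: map snd (p1 ++ (e1, w1) :: p2).
  have : u \in kcomp G psi a b x.
    by rewrite (closed_incident (kcomp_closed G psi a b x) abf
      (joins_incidentl fuv) (incident_src G f)).
  by move/(kcomp_sub cl); rewrite !in_set; apply; rewrite mem_head.
(* The end [u] in [W0] is not the last vertex, which lies outside; so [f] is an edge of the walk. *)
have ub1 : u \in belast x (map snd (p1 ++ (e1, w1) :: p2)).
  rewrite map_cat -cat_cons mem_cat in uc; case/orP: uc => [uc|/out2];
    last by rewrite uW.
  rewrite map_cat belast_cat mem_cat /=.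
  by move: uc; rewrite lastI mem_rcons !inE => /orP[->|->]; rewrite ?orbT.
have := alt_walk_inner (good_proper gd) mx w ub1 abf (joins_incidentl fuv).
move: w; rewrite alt_walk_cat => /andP[wa /= /and3P[_ _ wb]].
rewrite map_cat mem_cat /= in_cons => /or3P[fp|fe|fp]; last 2 first.
- by rewrite in_set1.
- have := alt_walk_edges wb fp (joins_incidentl fuv).
  by move/(out2 u); rewrite uW.
- by have := in1 _ (alt_walk_edges wa fp (joins_incidentr fuv)); rewrite (negPf vW).
Qed.

Lemma exposed_out psi b c d Z : exposed psi b -> kempe_closed G psi c d Z ->
  [disjoint Z & W0] -> exposed (swap G psi c d Z) b.
Proof.
move=> [gd mx ub] cl dis; split; first exact: good_swap_out.
  by rewrite missing_swap_notin // (disjointFl dis).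
suff -> : tcols (swap G psi c d Z) T = tcols psi T by [].
apply/eq_in_map => f fT; apply: (swap_notin cl (incident_src G f)).
by rewrite (disjointFl dis) // (tree_edge_W fT) // incident_src.
Qed.

Lemma probe_out psi a b c d Z : probe psi a b -> kempe_closed G psi c d Z ->
  [disjoint Z & W0] -> probe (swap G psi c d Z) a b.
Proof.
move=> [ex na two] cl dis; split; first exact: exposed_out.
  by move=> y yW; rewrite missing_swap_notin ?na // (disjointFl dis).
suff -> : crossing_col G (swap G psi c d Z) W0 a = crossing_col G psi W0 a by [].
apply/setP => f; rewrite !in_set; case cf: (crossing G W0 f); rewrite ?andbF // !andbT.
have [u [v [uW _ fuv]]] := crossing_end cf.
by rewrite (swap_notin cl (joins_incidentl fuv)) // (disjointFl dis).
Qed.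

Lemma exposed_in psi b c y : exposed psi b -> y \in W0 -> missing G psi y c ->
  exposed (swap G psi b c W0) c.
Proof.
move=> [gd mx ub] yW my; have cl := W_kempe_closed gd xW yW mx my.
split; first exact: good_swap_in.
  by rewrite missing_swap // xW tpermR.
apply: contra ub => /tcolsP[f fT fc]; apply/tcolsP; exists f => //.
move: fc; rewrite /swap (tree_edge_W fT) ?incident_src // => /eqP.
by rewrite omap_tperm_eq tpermR => /eqP.
Qed.

Lemma avoids_neq psi a c y : avoids psi a -> y \in W0 -> missing G psi y c -> a != c.
Proof. by move=> na yW my; apply: contraTneq my => <-; apply: na. Qed.

Lemma avoids_in psi a b c y : exposed psi b -> y \in W0 -> missing G psi y c ->
  avoids psi a -> avoids (swap G psi b c W0) a.
Proof.
move=> [gd mx ub] yW my na z zW; have cl := W_kempe_closed gd xW yW mx my.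
by rewrite missing_swapD ?na // (avoids_neq na _ mx, avoids_neq na _ my).
Qed.

Lemma probe_in psi a b c y : probe psi a b -> y \in W0 -> missing G psi y c ->
  probe (swap G psi b c W0) a c.
Proof.
move=> [ex na two] yW my; split; first exact: exposed_in ex yW my.
  exact: avoids_in ex yW my na.
suff -> : crossing_col G (swap G psi b c W0) W0 a = crossing_col G psi W0 a by [].
have [_ mx _] := ex.
by apply/setP => f; rewrite !in_set swap_colD //
  (avoids_neq na _ mx, avoids_neq na _ my).
Qed.

(* After renaming [b] to [c] inside [W], the (c,d)-component of [x] carries every
   crossing edge coloured [d], so the vertices outside it and outside [W] are closed. *)
Lemma outside_swap psi b c d y w1 w2 : exposed psi b -> y \in W0 -> missing G psi y c ->
  avoids psi d -> w1 \notin W0 -> w2 \notin W0 -> missing G psi w1 d ->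
  missing G psi w2 c -> w1 != w2 ->
  exists Z, [/\ kempe_closed G psi c d Z, [disjoint Z & W0] & (w1 \in Z) || (w2 \in Z)].
Proof.
move=> ex yW my nd w1W w2W m1 m2 n12; have [gd mx ub] := ex.
have cl := W_kempe_closed gd xW yW mx my.
have ex' := exposed_in ex yW my; have nd' := avoids_in ex yW my nd.
set psi' := swap G psi b c W0 in ex' nd'; have [gd' mx' _] := ex'.
pose X := kcomp G psi' d c x; have clX := kcomp_closed G psi' d c x.
exists (~: (X :|: W0)); split.
- have half f u v : bicol psi c d f -> joins G f u v ->
      u \in ~: (X :|: W0) -> v \in ~: (X :|: W0).
    rewrite !in_setC !in_setU !negb_or => cdf fuv /andP[uX uW].
    have uf := joins_incidentl fuv.
    have eqf : psi' f = psi f by apply: swap_notin cl uf uW.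
    have dcf : bicol psi' d c f by rewrite bicolC /bicol eqf.
    rewrite -(closed_joins clX dcf fuv) uX /=; apply/negP => vW.
    have cf : crossing G W0 f by rewrite (crossing_joins _ fuv) vW (negPf uW).
    case/orP: cdf => /eqP fc; first by rewrite (good_not_crossing gd yW my fc) in cf.
    rewrite -eqf in fc; have sX := crossing_in_comp ex' nd' fc cf.
    by move: uX; rewrite (closed_incident clX dcf uf (incident_src G f)) sX.
  move=> f cdf; apply/idP/idP; apply: half cdf _; first exact: joins_srcdst.
  by rewrite joinsC joins_srcdst.
- by rewrite disjoints_subset setCS subsetUr.
- rewrite !in_setC !in_setU (negPf w1W) (negPf w2W) !orbF -negb_and.
  apply/negP => /andP[c1 c2]; case/negP: n12; apply/eqP.
  apply: (kcomp_two_ends (good_proper gd') _ _ _ c1 c2).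
  + by rewrite mx' orbT.
  + by rewrite missing_swap_notin // m1.
  + by rewrite [X in _ || X]missing_swap_notin // m2 orbT.
  + by apply: contraNneq w1W => ->.
  + by apply: contraNneq w2W => ->.
Qed.

(** * The first excursion out of [W] *)

Section Excursion.
Variables (a b : 'I_k) (A B : seq (E * V)).
Hypothesis A_in : {subset x :: map snd A <= W0}.
Hypothesis B_out : forall v, v \in map snd B -> v \notin W0.
Hypothesis AB_uniq : uniq (x :: map snd (A ++ B)).

(** The edges are fixed, [A] inside [W0] and [B] visiting outside vertices, while the colouring
    varies. *)
Definition excursion psi := probe psi a b /\ alt_walk G psi a b x (A ++ B).

Lemma excursion_ends psi w : excursion psi -> w \in map snd B ->
  ~~ missing G psi w a /\ ~~ missing G psi w b.
Proof.
move=> [pr wk] /mapP[[e w'] wB /= ->].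
case/splitPr eB: _ / wB => [B1 B2].
have eB' : B = rcons B1 (e, w') ++ B2 by rewrite eB cat_rcons.
move: wk; rewrite eB' catA alt_walk_cat => /andP[wk _].
have := probe_return pr wk A_in; rewrite map_cat map_rcons last_cat last_rcons.
apply; first by case: (B1).
by move=> v vB; apply: B_out; rewrite eB' map_cat mem_cat map_rcons vB.
Qed.

Lemma excursion_neq psi w c : excursion psi -> w \in map snd B -> missing G psi w c ->
  (c != a) && (c != b).
Proof.
move=> iv wB mw; have [ma mb] := excursion_ends iv wB.
by apply/andP; split; apply: contraTneq mw => ->.
Qed.

Lemma excursion_swap psi c d Z : excursion psi -> kempe_closed G psi c d Z ->
  (c != a) && (c != b) -> (d != a) && (d != b) ->
  tashkinov_tree G (swap G psi c d Z) e0 T -> excursion (swap G psi c d Z).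
Proof.
move=> [[[gd mx ub] na two] wk] cl /andP[ca cb] /andP[da db] t.
have ca' : a != c by rewrite eq_sym. have cb' : b != c by rewrite eq_sym.
have da' : a != d by rewrite eq_sym. have db' : b != d by rewrite eq_sym.
split; last first.
  by apply: alt_walk_recolour wk => f _ fc; apply/eqP; rewrite swap_colD // fc.
split.
- split; first exact: good_swap.
    by rewrite missing_swapD.
  apply: contra ub => /tcolsP[f fT /eqP]; rewrite swap_colD // => /eqP fb.
  by apply/tcolsP; exists f.
- by move=> y yW; rewrite missing_swapD ?na.
- suff -> : crossing_col G (swap G psi c d Z) W0 a = crossing_col G psi W0 a by [].
  by apply/setP => f; rewrite !in_set swap_colD.
Qed.

(** The edge [e] between [w'] and [w] can be recoloured [d]. Then the walk cut at [w'] still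
    alternates, but [w'] misses the former colour of [e], against [probe_return]. *)
Lemma consecutive_no_common psi B0 B2 e' w' e w d : excursion psi ->
  B = B0 ++ (e', w') :: (e, w) :: B2 ->
  missing G psi w' d -> missing G psi w d -> False.
Proof.
move=> iv eB m' m; have [pr wk] := iv.
have eB' : A ++ B = (A ++ rcons B0 (e', w')) ++ (e, w) :: B2.
  by rewrite eB -catA cat_rcons.
have w'B : w' \in map snd B by rewrite eB map_cat mem_cat /= in_cons eqxx orbT.
have wB : w \in map snd B by rewrite eB map_cat mem_cat /= !in_cons eqxx !orbT.
move: wk; rewrite eB' alt_walk_cat => /andP[wk /= /and3P[ew /eqP ec _]].
rewrite !map_cat map_rcons !last_cat last_rcons in ew.
set q := A ++ _ in wk ec eB'.
set kap := (if _ then b else a) in ec.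
have kab : (kap == a) || (kap == b) by rewrite /kap; case: ifP; rewrite eqxx ?orbT.
have /andP[da db] := excursion_neq iv w'B m'.
have wq : w \notin x :: map snd q.
  move: AB_uniq; rewrite eB' map_cat -cat_cons cat_uniq => /and3P[_ /hasPn h _].
  by apply: h; rewrite /= mem_head.
have [[gd mx ub] na two] := pr; have proper := good_proper gd.
set Z := [set w'; w].
have Ze v : v \in Z -> incident G v e.
  by rewrite !inE => /orP[]/eqP->;
    [apply: joins_incidentl ew|apply: joins_incidentr ew].
have eZ v : incident G v e -> v \in Z by move=> /(joins_incident ew); rewrite !inE.
have mZ v : v \in Z -> missing G psi v d by rewrite !inE => /orP[]/eqP->.
have Zk f v : v \in Z -> incident G v f -> psi f = Some kap -> f = e.
  by move=> vZ vf fc; apply: (proper_inj proper vf (Ze v vZ) fc ec).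
have cl : kempe_closed G psi kap d Z.
  have half f u v : bicol psi kap d f -> u \in Z -> incident G u f ->
      incident G v f -> v \in Z.
    move=> /orP[]/eqP fc uZ uf vf; last by case: (missingP (mZ u uZ) uf).
    by apply: eZ; rewrite -(Zk f u).
  move=> f fc; apply/idP/idP => h1.
    exact: half fc h1 (incident_src G f) (incident_dst G f).
  exact: half fc h1 (incident_dst G f) (incident_src G f).
have dis : [disjoint Z & W0].
  rewrite disjoints_subset; apply/subsetP => v; rewrite in_setC !inE => /orP[]/eqP->;
  exact: B_out.
have pr' := probe_out pr cl dis.
(* [e] is not an edge of [q], because its end [w] is not on [q]. *)
have keep f : f \in map fst q -> swap G psi kap d Z f = psi f.
  move=> fq; rewrite /swap; case: ifP => // sZ; apply: omap_tperm_id.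
  apply/norP; split; apply/eqP => fc;
    last by case: (missingP (mZ _ sZ) (incident_src G f)).
  have fe := Zk f _ sZ (incident_src G f) fc.
  case/negP: wq; apply: alt_walk_edges wk fq _; rewrite fe; exact: joins_incidentr ew.
have wk' : alt_walk G (swap G psi kap d Z) a b x q.
  by apply: alt_walk_recolour wk => f fq fc; rewrite keep.
have [] := probe_return pr' wk' A_in.
- by case: (B0).
- move=> v vB; apply: B_out; rewrite eB -cat_rcons map_cat mem_cat.
  by rewrite vB.
rewrite !map_cat map_rcons !last_cat last_rcons.
have : missing G (swap G psi kap d Z) w' kap
  by rewrite missing_swap // !inE eqxx tpermL.
by case/orP: kab => /eqP-> ->.
Qed.

(** Exchanging [b] and [c] inside [W0] turns the walk up to [w] into one alternating between [a] and
    [c], its last edge being coloured [a] since no edge coloured [b] leaves [W0]. It stops at a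
    vertex missing [c], against [probe_return]. *)
Lemma first_exit_no_common psi e w B2 c y : excursion psi -> B = (e, w) :: B2 ->
  y \in W0 ->
  missing G psi y c -> missing G psi w c -> False.
Proof.
move=> iv eB yW my mw; have [pr wk] := iv; have [[gd mx ub] na two] := pr.
have wB : w \in map snd B by rewrite eB mem_head.
have wW := B_out wB; have cl := W_kempe_closed gd xW yW mx my.
have pr' := probe_in pr yW my.
have eB' : A ++ B = (A ++ [:: (e, w)]) ++ B2 by rewrite eB -catA.
move: wk; rewrite eB' alt_walk_cat => /andP[wk _].
have /and3P[ew _ _] : [&& joins G e (last x (map snd A)) w, true & true].
  by move: wk; rewrite alt_walk_cat /= => /and3P[_ -> _].
have lW : last x (map snd A) \in W0 by apply: A_in; apply: mem_last.
have wk' : alt_walk G (swap G psi b c W0) a c x (A ++ [:: (e, w)]).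
  apply: alt_walk_recolour (wk) => f; rewrite map_cat mem_cat => fA fc.
    by apply/eqP; rewrite swap_colD ?fc // (avoids_neq na _ mx, avoids_neq na _ my).
  case/orP: fA => [fA|]; last first.
    rewrite inE => /eqP fe; rewrite fe in fc.
    have := good_not_crossing gd xW mx fc.
    by rewrite (crossing_joins _ ew) lW (negPf wW).
  have wkA : alt_walk G psi a b x A by move: wk; rewrite alt_walk_cat => /andP[].
  have sW : src G f \in W0.
    by apply: A_in; apply: alt_walk_edges wkA fA (incident_src G f).
  by rewrite /swap sW fc /= tpermL.
have [] := probe_return pr' wk' A_in => //.
  by move=> v; rewrite inE => /eqP->.
by rewrite map_cat last_cat /= => _; rewrite missing_swap_notin // mw.
Qed.

(** Induction on the initial part [B1] of the excursion, for all colourings at once so that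
    recolouring is possible. The new vertex [w] is compared with [W0] in [noA] and with earlier
    excursion vertices in [noB]. *)
Lemma excursion_elem B1 B2 psi u v c : B = B1 ++ B2 -> excursion psi ->
  (u \in W0) || (u \in map snd B1) -> (v \in W0) || (v \in map snd B1) ->
  missing G psi u c -> missing G psi v c -> u = v.
Proof.
elim/last_ind: B1 B2 psi u v c => [|B1 [e w] IH] B2 psi u v c eB iv.
  rewrite !in_nil !orbF; have [[[gd _ _] _ _] _] := iv.
  exact: good_elem gd.
have {}IH := IH ((e, w) :: B2).
have eB1 : B = B1 ++ (e, w) :: B2 by rewrite eB cat_rcons.
have wB : w \in map snd B by rewrite eB1 map_cat mem_cat /= in_cons eqxx orbT.
have sB1 z : z \in map snd B1 -> z \in map snd B.
  by rewrite eB1 map_cat mem_cat => ->.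
have nB1 z d psi' : excursion psi' -> z \in map snd B1 -> missing G psi' z d ->
  avoids psi' d.
  move=> iv' zB mz y yW; apply/negP => my.
  have e1 : y = z by apply: (IH psi' y z d) => //; rewrite ?yW ?zB ?orbT.
  by have := B_out (sB1 _ zB); rewrite -e1 yW.
have noA psi' y d : excursion psi' -> y \in W0 -> missing G psi' y d ->
  missing G psi' w d -> False.
  move=> iv' yW my mw; case/lastP eB0: B1 => [|B0 [e' w']].
    by apply: (first_exit_no_common iv' _ yW my mw (B2 := B2)); rewrite eB1 eB0.
  have w'B1 : w' \in map snd B1 by rewrite eB0 map_rcons mem_rcons mem_head.
  have w'B := sB1 _ w'B1.
  have [[ex na two] wk] := iv'; have [gd _ _] := ex.
  have [d' m'] := good_missing w' gd.
  have nd' := nB1 _ _ _ iv' w'B1 m'.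
  have n12 : w' != w.
    apply: contraNneq (nd' y yW) => e1; have := nB1 _ _ _ iv' w'B1;
      rewrite e1 => /(_ d mw).
    by move=> /(_ y yW); rewrite my.
  (* If [w'] lies in [Z], the swap makes it miss [d] like [y], against induction. If only [w] does,
     then [w'] and [w] both miss [d']. *)
  have [Z [cl dis hZ]] := outside_swap ex yW my nd' (B_out w'B) (B_out wB) m' mw n12.
  have gd2 := good_swap_out gd cl dis.
  have iv2 : excursion (swap G psi' d d' Z).
    by apply: excursion_swap => //;
      [apply: excursion_neq mw|apply: excursion_neq m'|case: gd2].
  case w'Z: (w' \in Z).
    have m2 : missing G (swap G psi' d d' Z) w' d by rewrite missing_swap // w'Z tpermL.
    have := nB1 _ _ _ iv2 w'B1 m2 y yW.
    by rewrite missing_swap_notin ?my // (disjointFl dis).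
  rewrite w'Z /= in hZ.
  apply: (consecutive_no_common iv2 (B0 := B0) (B2 := B2) (d := d')).
  - by rewrite eB1 eB0 cat_rcons.
  - by rewrite missing_swap // w'Z.
  - by rewrite missing_swap // hZ tpermR.
have noB psi' D1 D2 ei wi d : B1 = D1 ++ (ei, wi) :: D2 -> excursion psi' ->
    missing G psi' wi d -> missing G psi' w d -> False.
  (* Induction on the number of vertices between [wi] and [w]: the shared colour is moved one vertex
     closer to [w]. *)
  elim: D2 psi' D1 ei wi d => [|[e1 w1] D3 IHD] psi' D1 ei wi d eD iv' mi mw.
    apply: (consecutive_no_common iv' (B0 := D1) (B2 := B2) _ mi mw).
    by rewrite eB1 eD -catA.
  have wiB1 : wi \in map snd B1 by rewrite eD map_cat mem_cat /= in_cons eqxx orbT.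
  have w1B1 : w1 \in map snd B1 by rewrite eD map_cat mem_cat /= !in_cons eqxx !orbT.
  have un : [&& wi != w1, wi != w & w1 != w].
    move: AB_uniq; rewrite eB1 eD /= map_cat cat_uniq => /and4P[_ _ _].
    rewrite -catA map_cat cat_uniq /= => /and3P[_ _] /and3P[h1 h2 _].
    move: h1 h2; rewrite map_cat /= !in_cons !mem_cat !in_cons !negb_or.
    by move=> /and4P[-> _ -> _] /and3P[_ -> _].
  case/and3P: un => ni1 niw n1w.
  have [[ex na two] wk] := iv'; have [gd _ _] := ex.
  have [d' m1] := good_missing w1 gd.
  have nd := nB1 _ _ _ iv' wiB1 mi; have nd' := nB1 _ _ _ iv' w1B1 m1.
  have cl := kcomp_closed G psi' d d' w1.
  have iv2 : excursion (swap G psi' d d' (kcomp G psi' d d' w1)).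
    apply: excursion_swap => //; [exact: excursion_neq mw|exact: excursion_neq (sB1 _
      w1B1) m1|].
    by apply: tree_swap_unused => //; [exact: good_unused|exact: good_unused|case: gd].
  have m1' : missing G (swap G psi' d d' (kcomp G psi' d d' w1)) w1 d.
    by rewrite missing_swap // kcomp_refl tpermL.
  (* If [w] is in the component of [w1], then [wi] is not, as there are only two ends, and [wi] and
     [w1] both miss [d] after the swap. Otherwise [w] still misses [d] and shares it with [w1]. *)
  case wY: (w \in kcomp G psi' d d' w1).
    have wiY : wi \notin kcomp G psi' d d' w1.
      apply/negP => wiY; case/negP: niw; apply/eqP.
      apply: (kcomp_two_ends (good_proper gd) _ _ _ wiY wY) => //.
      + by rewrite m1 orbT.
      + by rewrite mi.
      + by rewrite mw.
      + by rewrite eq_sym.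
    have e2 : wi = w1.
      apply: (IH _ wi w1 d eB1 iv2) => //; rewrite ?wiB1 ?w1B1 ?orbT //.
      by rewrite missing_swap_notin.
    by rewrite e2 eqxx in ni1.
  apply: (IHD (swap G psi' d d' (kcomp G psi' d d' w1)) (rcons D1 (ei, wi)) e1 w1 d) =>
    //.
    by rewrite eD cat_rcons.
  by rewrite missing_swap // wY.
have sym z : (z \in W0) || (z \in map snd B1) -> missing G psi z c ->
  missing G psi w c -> False.
  case/orP=> [zW|/mapP[[ei wi] zB /= ->]]; first exact: noA.
  by case/splitPr eD: _ / zB => [D1 D2] mz mw; apply: (noB psi D1 D2 ei wi c).
rewrite map_rcons !mem_rcons !in_cons !(orbCA _ (_ == w)).
case/orP=> [/eqP->|uB] /orP[/eqP->|vB] // mu mv.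
- by case: (sym v).
- by case: (sym u).
- exact: IH eB1 iv uB vB mu mv.
Qed.

End Excursion.
End Probe.
End Main.

(** * Counting edges *)

Section Counting.
Variables (V E : finType) (G : graph V E).
Hypothesis G_loopless : loopless G.
Implicit Types (X : {set V}).

Definition inner_col k (psi : E -> option 'I_k) X c :=
  [set f | (psi f == Some c) && ((src G f \in X) && (dst G f \in X))].

Lemma card_set_sum (I : finType) (p : pred I) : #|[set i | p i]| = \sum_i (p i : nat).
Proof. by rewrite -sum1dep_card big_mkcond; apply: eq_bigr => i _; case: (p i). Qed.

Lemma sum_eq_mem X u : \sum_(v in X) (u == v : nat) = (u \in X).
Proof.
rewrite big_mkcond (bigD1 u) //= eqxx big1 ?addn0 => [|v /negPf nv].
  by case: (u \in X).
by rewrite eq_sym nv if_same.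
Qed.

(** Count the incidences between [X] and edges coloured [c]: an inner edge is met twice, not being a
    loop, and a crossing edge once. *)
Lemma sum_coloured k (psi : E -> option 'I_k) X c : partial_colouring G psi ->
  \sum_(v in X) (~~ missing G psi v c : nat) =
  2 * #|inner_col psi X c| + #|crossing_col G psi X c|.
Proof.
move=> pc.
have colv v : (~~ missing G psi v c : nat) = \sum_f (incident G v f && (psi f == Some
  c) : nat).
  rewrite negbK; case: existsP => [[f /andP[vf /eqP fc]]|nf] /=.
    rewrite (bigD1 f) //= vf fc eqxx big1 // => g ngf.
    case: andP => // -[vg /eqP gc]; move: ngf.
    by rewrite (proper_inj pc vg vf gc fc) eqxx.
  by rewrite big1 // => f _; case h: (_ && _) => //; case: nf; exists f.
rewrite (eq_bigr _ (fun v _ =>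
  colv v)) exchange_big /= !card_set_sum big_distrr -big_split /=.
apply: eq_bigr => f _; case: (psi f == Some c); last first.
  by rewrite /= big1 // => v _; rewrite andbF.
rewrite (eq_bigr (fun v => (src G f == v) + (dst G f == v))) => [|v _].
  rewrite big_split !sum_eq_mem /crossing /=.
  by case: (src G f \in X); case: (dst G f \in X).
rewrite andbT /incident; case: eqP => // <-.
by rewrite eq_sym (negPf (G_loopless f)).
Qed.

Lemma sum_inner_col k (psi : E -> option 'I_k) X :
  \sum_c #|inner_col psi X c| =
  #|[set f | (psi f != None) && ((src G f \in X) && (dst G f \in X))]|.
Proof.
rewrite (eq_bigr _ (fun c _ => card_set_sum _)) exchange_big card_set_sum /=.
apply: eq_bigr => f _; case: (psi f) => [d|] /=; last by rewrite big1.
rewrite (bigD1 d) //= eqxx /= big1 ?addn0 // => c ncd.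
by rewrite (_ : (Some d == Some c) = false) //; apply: contraNF ncd => /eqP[->].
Qed.

(** Each colour class is a matching, so parity leaves it at most half of [#|X|.-1] edges inside
    [X]. *)
Lemma inner_edges_bound n X : colourable G n -> odd #|X| ->
  2 * inner_edges G X <= n * #|X|.-1.
Proof.
case/existsP=> c /forallP pc oX; pose psi f := Some (c f).
have pr : partial_colouring G psi.
  move=> e f nef adj _; have /forallP/(_ f) := pc e; rewrite nef adj /=.
  by apply: contra => /eqP[->].
have -> : inner_edges G X = \sum_d #|inner_col psi X d|.
  by rewrite sum_inner_col /inner_edges; congr #|pred_of_set _|; apply/setP => f;
    rewrite !in_set.
rewrite big_distrr /= -[n in X in _ <= X]card_ord -sum_nat_const; apply: leq_sum => d _.
have := sum_coloured X d pr.
have : \sum_(v in X) (~~ missing G psi v d : nat) <= #|X|.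
  by rewrite -sum1_card; apply: leq_sum => v _; case: (~~ _).
move: #|inner_col psi X d| #|crossing_col G psi X d| => i j.
move: (\sum_(v in X) _) #|X| oX => s [|m] //= om h1 h2.
have {}h1 : 2 * i <= m.+1 by apply: leq_trans h1; rewrite h2 leq_addr.
rewrite leq_eqVlt in h1; case/orP: h1 => // /eqP e1.
by have := congr1 odd e1; rewrite mul2n odd_double /= (negPf om).
Qed.

Lemma rho_le_chromatic_index X :
  (Num.ceil (rho G X) <= (chromatic_index G)%:Z)%R.
Proof.
rewrite ceil_le_int; apply: bigmax_le => [|S /and3P[_ oS gS]]; first by rewrite ler0z.
have pos : (0 < (#|S|.-1)%:R :> rat)%R by rewrite ltr0n; lia.
rewrite ler_pdivrMr // -pmulrn -natrM ler_nat.
by apply: inner_edges_bound => //; rewrite /chromatic_index; case: ex_minnP.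
Qed.

Lemma rho_gt k X : odd #|X| -> 2 < #|X| -> k * #|X|.-1 < 2 * inner_edges G X ->
  (k%:Z < Num.ceil (rho G X))%R.
Proof.
move=> oX gX lt; rewrite ceil_gt_int.
have pos : (0 < (#|X|.-1)%:R :> rat)%R by rewrite ltr0n; lia.
apply: (@lt_le_trans _ _ (((2 * inner_edges G X)%:R / (#|X|.-1)%:R)%R : rat)).
  by rewrite ltr_pdivlMr // -pmulrn -natrM ltr_nat.
by apply: (bigmax_sup X); rewrite ?subxx ?oX.
Qed.

End Counting.

(** * Deriving (a), (b) and (c) *)

Theorem theorem2 (V E : finType) (G : graph V E) (k : nat)
    (phi : E -> option 'I_k) (e0 : E) (T : seq (V * E)) :
  loopless G ->
  (max_degree G).+2 <= chromatic_index G ->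
  (max_degree G).+1 <= k ->
  partial_colouring G phi ->
  phi e0 = None ->
  max_tashkinov_tree G phi e0 T ->
  (* not (1) *)
  ~ (exists phi', kempe_reach G phi phi' /\ partial_colouring G phi' /\
       exists c, missing G phi' (src G e0) c && missing G phi' (dst G e0) c) ->
  (* not (2) *)
  ~ (exists phi', kempe_reach G phi phi' /\ partial_colouring G phi' /\
       #|W G phi e0| < #|W G phi' e0|) ->
  (* not (3) *)
  ~ ((Num.ceil (rho G (W G phi e0)) <= (chromatic_index G)%:Z)%R /\
     ((k%:Z) < Num.ceil (rho G (W G phi e0)))%R) ->
  let W0 := W G phi e0 in
  (* (a) *)
  (elementary G phi W0 /\ Dset G phi W0 != set0 /\
   forall c, c \in Dset G phi W0 -> odd #|crossing_col G phi W0 c|) /\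
  (* (b) and (c) *)
  (forall (alpha beta : 'I_k), beta \in Mset G phi W0 -> beta \notin U_T phi e0 T ->
     alpha \in Dset G phi W0 ->
     forall (x : V) (P : seq (E * V)), x \in W0 -> missing G phi x beta ->
       max_alt_path G phi alpha beta x P ->
       let outs := [seq v <- pverts x P | v \notin W0] in
       let s := drop (find (fun v => v \notin W0) (pverts x P)) (pverts x P) in
       let VQ := take (find (fun v => v \in W0) s) s in
       (forall f, phi f = Some alpha -> crossing G W0 f -> f \in map fst P) /\
       elementary G phi (W0 :|: [set v in take 2 outs]) /\
       elementary G phi (W0 :|: [set v in VQ])).
Proof.
move=> Gl _ kl pc p0 Tm n1 n2 n3 W0.
have no_common psi : kempe_reach G phi psi ->
    forall c, ~~ (missing G psi (src G e0) c && missing G psi (dst G e0) c).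
  move=> re c; apply/negP => m; apply: n1; exists psi; split => //.
  by split; [apply: kempe_reach_proper re|exists c].
have W_max psi : kempe_reach G phi psi -> #|W G psi e0| <= #|W G phi e0|.
  move=> re; rewrite leqNgt; apply/negP => lt; apply: n2; exists psi; split => //.
  by split => //; apply: kempe_reach_proper re.
have gd := phi_good Tm.
have el x y c : x \in W0 -> y \in W0 -> missing G phi x c -> missing G phi y c -> x = y.
  exact: (good_elem Gl kl pc p0 Tm no_common gd).
have ncross x c f : x \in W0 -> missing G phi x c -> phi f = Some c ->
  crossing G W0 f = false.
  exact: (good_not_crossing Tm W_max gd).
have cross0 x c : x \in W0 -> missing G phi x c -> #|crossing_col G phi W0 c| = 0.
  move=> xW mx; apply: eq_card0 => f; rewrite inE; apply/negP => /andP[/eqP fc].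
  by rewrite (ncross x c).
(* By elementarity [x] is the only vertex of [W0] missing [c], and no edge coloured [c] crosses; so
   [W0] has odd size. *)
have sum_in x c : x \in W0 -> missing G phi x c ->
    #|W0| = (2 * #|inner_col G phi W0 c|).+1.
  move=> xW mx; have := sum_coloured Gl W0 c pc; rewrite (cross0 x) // addn0 => <-.
  rewrite -sum1_card (bigD1 x) //= add1n [in RHS](bigD1 x) //= mx add0n; congr S.
  apply: eq_bigr => v /andP[vW nv]; case mv: (missing G phi v c) => //.
  by rewrite (el v x c) ?eqxx in nv.
have sum_out c : (forall x, x \in W0 -> ~~ missing G phi x c) ->
    #|W0| = 2 * #|inner_col G phi W0 c| + #|crossing_col G phi W0 c|.
  move=> nm; rewrite -sum_coloured // -sum1_card; apply: eq_bigr => v vW.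
  by rewrite nm.
have sW : src G e0 \in W0 by rewrite (mem_W0 Tm) mem_head.
have dW : dst G e0 \in W0 by rewrite (mem_W0 Tm) !in_cons eqxx orbT.
have [c0 mc0] := exists_missing kl (src G e0) p0.
have oW : odd #|W0| by rewrite (sum_in _ _ sW mc0) mul2n /= odd_double.
have outM c : #|crossing_col G phi W0 c| != 0 -> forall x, x \in W0 ->
  ~~ missing G phi x c.
  by move=> nc x xW; apply: contraNN nc => mx; rewrite (cross0 x).
have odd_out c : #|crossing_col G phi W0 c| != 0 -> odd #|crossing_col G phi W0 c|.
  by move=> /outM/sum_out h; move: oW; rewrite h oddD mul2n odd_double.
split.
  split; first by move=> x y xW yW nxy c; apply/negP => /andP[mx my];
    rewrite (el x y c) ?eqxx in nxy.
  split; last by move=> c; rewrite inE => h; apply: odd_out; case: #|_| h.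
  (* Without defective colours, each of the [k] colours has exactly half of [#|W0|.-1] edges inside
     [W0]. The uncoloured [e0] then raises the density above [k], which is (3). *)
  apply/negP => /eqP D0; apply: n3; split; first exact: rho_le_chromatic_index.
  have gW : 2 < #|W0|.
    have : #|[set src G e0; dst G e0]| <= #|W0|.
      by apply: subset_leq_card; apply/subsetP => v; rewrite !inE => /orP[]/eqP->.
    by rewrite cards2 (Gl e0); case: #|W0| oW => [|[|[]]].
  apply: rho_gt => //.
  have half c : 2 * #|inner_col G phi W0 c| = #|W0|.-1.
    have : c \notin Dset G phi W0 by rewrite D0 inE.
    rewrite inE -leqNgt => le1.
    case: (pickP [pred x | (x \in W0) && missing G phi x c]) => [x /andP[xW mx]|nm].
      by rewrite (sum_in x c).
    have nm' x : x \in W0 -> ~~ missing G phi x c by move=> xW; have := nm x;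
      rewrite /= xW /= => ->.
    (* A colour missing nowhere in [W0] crosses an odd number of times, hence exactly once. *)
    have h := sum_out c nm'; move: oW le1; rewrite h oddD mul2n odd_double /=.
    by case: #|crossing_col _ _ _ _| => [|[|]] //; rewrite addn1.
  have := sum_inner_col G phi W0.
  set inn := [set f | _] => hs.
  have lt : #|inn| < inner_edges G W0.
    rewrite /inner_edges [X in _ < X](cardsD1 e0) in_set sW dW add1n ltnS;
      apply: subset_leq_card.
    apply/subsetP => f; rewrite !inE => /andP[nf ->]; rewrite andbT.
    by apply: contraNneq nf => ->; rewrite p0.
  have : 2 * #|inn| = k * #|W0|.-1.
    rewrite -hs big_distrr /= (eq_bigr _ (fun c _ => half c)) sum_nat_const card_ord //.
  by move=> <-; rewrite ltn_pmul2l.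
move=> a b _ ub aD x P xW mx mP outs s VQ.
have two : 1 < #|crossing_col G phi W0 a| by move: aD; rewrite inE.
have na : forall y, y \in W0 -> ~~ missing G phi y a by apply: outM; case: #|_| two.
have ubT : Some b \notin tcols phi T.
  apply: contra ub => /tcolsP[f fT fb]; rewrite inE; apply/existsP; exists f.
  by rewrite fb eqxx andbT in_cons fT orbT.
have ex : exposed G e0 phi T x phi b by split.
have pr : probe G e0 phi T x phi a b by split.
have /andP[/andP[wk un] _] := mP.
have f_in_P f : phi f = Some a -> crossing G W0 f -> f \in map fst P.
  move=> fa cf; have sX := crossing_in_comp Tm W_max xW ex na fa cf.
  have cl := kcomp_closed G phi a b x.
  have dX : dst G f \in kcomp G phi a b x by rewrite -(cl f) // bicol_l.
  have sP := kcomp_sub_path pc mx mP sX; have dP := kcomp_sub_path pc mx mP dX.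
  (* One end of [f] is not the last vertex of the path, as [f] is no loop; at that end all edges
     coloured [a] or [b] are on the path. *)
  rewrite lastI !mem_rcons !in_cons in sP dP.
  case/orP: sP => [/eqP sl|sb]; last first.
    exact (alt_walk_inner pc mx wk sb (bicol_l b fa) (incident_src G f)).
  case/orP: dP => [/eqP dl|db]; last first.
    exact (alt_walk_inner pc mx wk db (bicol_l b fa) (incident_dst G f)).
  by have := Gl f; rewrite sl dl eqxx.
set i := find (fun v => v \notin W0) (pverts x P).
(* [i] is positive because [x] is in [W0]; the shift by one is due to [P] not recording [x]. *)
have [i' ei] : exists i', i = i'.+1 by rewrite /i /= xW /=; eexists.
set j := find (fun v => v \in W0) s.
pose A := take i' P; pose B := take j (drop i' P).
have eP : P = A ++ B ++ drop j (drop i' P) by rewrite /A /B !cat_take_drop.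
have es : s = map snd (drop i' P) by rewrite /s -/i ei /= map_drop.
have eVQ : VQ = map snd B by rewrite /VQ -/j es /B map_take.
have A_in : {subset x :: map snd A <= W0}.
  have -> : x :: map snd A = take i (pverts x P) by rewrite ei /= /A map_take.
  move=> v vA; have := allP (all_take_find (fun v => v \notin W0) (pverts x P)) v vA.
  by rewrite /= negbK.
have B_out v : v \in map snd B -> v \notin W0.
  by rewrite -eVQ => /(allP (all_take_find _ _)).
have AB_uniq : uniq (x :: map snd (A ++ B)).
  by move: un; rewrite {1}eP catA map_cat -cat_cons cat_uniq => /and3P[].
have iv : excursion G e0 phi T x a b A B phi.
  by split => //; move: wk; rewrite {1}eP catA alt_walk_cat => /andP[].
have elQ u v c : (u \in W0) || (u \in VQ) -> (v \in W0) || (v \in VQ) ->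
    missing G phi u c -> missing G phi v c -> u = v.
  rewrite eVQ; have eB : B = B ++ [::] by rewrite cats0.
  exact (excursion_elem Gl kl pc p0 Tm no_common W_max xW A_in B_out AB_uniq eB iv).
have elX (X : seq V) : {subset X <= VQ} -> elementary G phi (W0 :|: [set v in X]).
  move=> sX u v; rewrite !in_setU !in_set => uX vX nuv c; apply/negP => /andP[mu mv].
  have wX w : (w \in W0) || (w \in X) -> (w \in W0) || (w \in VQ).
    by case/orP=> [->//|/sX->]; rewrite orbT.
  have uv := elQ u v c (wX _ uX) (wX _ vX) mu mv.
  by rewrite uv eqxx in nuv.
split=> //; split; last exact: elX.
apply: elX => v; rewrite /outs.
have -> : pverts x P = take i (pverts x P) ++ s by rewrite cat_take_drop.
rewrite filter_cat (_ : [seq u <- take i (pverts x P) | u \notin W0] = [::]);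
  last first.
  by apply/eqP; rewrite -(negbK (_ == _)) -has_filter -all_predC; apply: all_take_find.
rewrite /=.
have -> : s = VQ ++ drop j s by rewrite cat_take_drop.
rewrite filter_cat (_ : [seq u <- VQ | u \notin W0] = VQ); last first.
  by apply/all_filterP; apply: (all_take_find (fun v => v \in W0)).
(* The first two outside vertices lie on the first excursion as soon as it has two vertices. *)
suff : s = [::] \/ 1 < size VQ.
  case=> [s0|sz]; first by rewrite /VQ s0.
  rewrite take_cat; case: ltnP => [_|le]; first by move/mem_take.
  have -> : size VQ = 2 by apply/eqP; rewrite eqn_leq le sz.
  by rewrite subnn take0 cats0.
have [s0|ns] := eqVneq s [::]; [by left | right].
have hs : has (fun v => v \notin W0) (pverts x P).
  rewrite has_find -/i ltnNge; apply/negP => le.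
  by move/eqP: ns; apply; rewrite /s -/i drop_oversize.
rewrite ltnNge; apply/negP => le.
have : 0 < j.
  rewrite /j; case es': s ns => [|w s'] //= _.
  have := nth_find x hs; rewrite -/i => h.
  have -> : w = nth x (pverts x P) i by have := nth_drop i x (pverts x P) 0;
    rewrite -/s es' /= addn0.
  by rewrite (negPf h).
have szB : size B <= 1 by rewrite -(size_map snd) -eVQ.
have := eP; rewrite /B.
have : drop i' P != [::] by apply: contraNneq ns => d0; rewrite es d0.
case eD: (drop i' P) => [|[e1 w1] D] // _ eP' j0.
have ej : j = 1.
  have jle : j <= size (drop i' P) by rewrite -(size_map snd) -es; apply: find_size.
  by apply/eqP; rewrite eqn_leq j0 andbT -(size_takel jle).
have eB : B = [:: (e1, w1)] by rewrite /B eD ej /= take0.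
rewrite ej /= take0 drop0 in eP'.
have w1B : w1 \in map snd B by rewrite eB mem_head.
have w1W := B_out _ w1B.
have lW : last x (map snd A) \in W0 by apply: A_in; apply: mem_last.
have bcross g u v' : joins G g u v' -> u \in W0 -> v' \notin W0 -> phi g = Some b ->
  False.
  move=> gj uW vW gb; have := ncross x b g xW mx gb.
  by rewrite (crossing_joins _ gj) uW (negPf vW).
(* The excursion is the single vertex [w1]. If the path ends there, the edge coloured [b] at [w1]
   leads back to a path vertex, so into [W0]; if it returns at once, one of two consecutive crossing
   edges is coloured [b]. Both contradict [bcross]. *)
case eD2: D eP' => [|[g z] D2] eP'.
  have [_ nb] := excursion_ends pc Tm W_max xW A_in B_out iv w1B.
  have [g w1g gb] := missingPn nb; have [z gz] := incident_joins w1g.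
  have cl := max_alt_path_closed pc mx mP.
  have := closed_joins cl (bicol_r a gb) gz; rewrite !in_set eP'.
  have -> : w1 \in x :: map snd (A ++ [:: (e1, w1)])
    by rewrite map_cat -cat_cons mem_cat mem_head orbT.
  move/esym; rewrite map_cat -cat_cons mem_cat => /orP[/A_in zW|].
    by apply: bcross zW w1W gb; rewrite joinsC.
  rewrite inE => /eqP zw; move: gz; rewrite zw /joins => /orP[]/andP[/eqP h1 /eqP h2];
  by have := Gl g; rewrite h1 h2 eqxx.
have zW : z \in W0.
  have hj : has (fun v => v \in W0) s.
    by rewrite has_find -/j ej es eD eD2.
  by have := nth_find x hj; rewrite -/j ej es eD eD2.
move: wk; rewrite eP' alt_walk_cat => /andP[_ /= /and5P[e1j /eqP e1c gj /eqP gc _]].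
move: e1c gc; case: (odd _) => e1c gc.
  exact: bcross e1j lW w1W e1c.
by apply: bcross zW w1W gc; rewrite joinsC.
Qed.
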